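(* Let $G$ be a totally disconnected locally compact group, $R$ a commutative ring, $n\in\mathbb{N}\cup\{\infty\}$, and let $0\to M'\xrightarrow{f}M\xrightarrow{g}M''\to0$ be a short exact sequence of discrete $R[G]$-modules. Then the following hold over $R$: (a) if $M'$ is of type $\mathrm{FP}_{n-1}$ and $M$ of type $\mathrm{FP}_n$, then $M''$ is of type $\mathrm{FP}_n$; (b) if $M$ is of type $\mathrm{FP}_{n-1}$ and $M''$ of type $\mathrm{FP}_n$, then $M'$ is of type $\mathrm{FP}_{n-1}$; (c) if $M'$ and $M''$ are of type $\mathrm{FP}_n$, then so is $M$.
   Context: An abstract left $R[G]$-module $M$ is discrete if the stabiliser of every $m\in M$ is open in $G$. A proper discrete permutation $R[G]$-module is a module $R[\Omega]$ freely $R$-spanned by a left $G$-set $\Omega$ all of whose point stabilisers are compact open subgroups of $G$. A discrete $R[G]$-module $M$ has type $\mathrm{FP}_n$ over $R$ ($n\in\mathbb{N}\cup\{\infty\}$) if it has a resolution $\cdots\to P_1\to P_0\to M\to0$ by proper discrete permutation $R[G]$-modules (not required to be projective) with $P_i$ finitely generated for all $i\le n$. Type $\mathrm{FP}_{-1}$ is no condition, and $\infty-1=\infty$. *)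

(* Defs.v *)
(* MathComp, with MathComp-Analysis for the topology on G. *)
From HB Require Import structures.
From mathcomp Require Import all_boot all_algebra.
From mathcomp Require Import all_classical all_reals all_analysis.

Set Implicit Arguments.
Unset Strict Implicit.
Unset Printing Implicit Defensive.

Import GRing.Theory.
Local Open Scope classical_set_scope.
Local Open Scope ring_scope.

HB.mixin Record isTopologicalGroup G of Topological G & Group G := {
  mulg_continuous : continuous (fun x : G * G => (x.1 * x.2)%g) ;
  invg_continuous : continuous (fun x : G => (x^-1)%g)
}.

#[short(type="topologicalGroupType")]
HB.structure Definition TopologicalGroup :=
  {G of Topological G & Group G & isTopologicalGroup G}.

Definition tdlc (G : topologicalGroupType) : Prop :=
  [/\ hausdorff_space G, locally_compact [set: G]
    & totally_disconnected [set: G]].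

Record gset (G : groupType) := GSet {
  gset_car :> Type ;
  gset_act : G -> gset_car -> gset_car ;
  gset_act1 : forall x, gset_act 1%g x = x ;
  gset_actM : forall g h x, gset_act (g * h)%g x = gset_act g (gset_act h x)
}.

(* Left modules over the group algebra R[G], presented as R-modules with an
   R-linear left action of G. *)
Record rgmodule (R : comPzRingType) (G : groupType) := RGModule {
  rgmod_car :> lmodType R ;
  rgmod_act : G -> {linear rgmod_car -> rgmod_car} ;
  rgmod_act1 : forall m, rgmod_act 1%g m = m ;
  rgmod_actM : forall g h m,
    rgmod_act (g * h)%g m = rgmod_act g (rgmod_act h m)
}.

Arguments rgmod_act {R G M} g : rename.

Record rghom (R : comPzRingType) (G : groupType) (M N : rgmodule R G) :=
  RGHom {
    rghom_fun :> {linear M -> N} ;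
    rghom_act : forall g m,
      rghom_fun (rgmod_act g m) = rgmod_act g (rghom_fun m)
  }.

Definition exact_at (R : comPzRingType) (G : groupType)
    (L M N : rgmodule R G) (f : rghom L M) (g : rghom M N) : Prop :=
  range f = [set m | g m = 0].

Definition short_exact (R : comPzRingType) (G : groupType)
    (L M N : rgmodule R G) (f : rghom L M) (g : rghom M N) : Prop :=
  [/\ injective f, exact_at f g & range g = [set: N]].

Definition discrete_module (R : comPzRingType) (G : topologicalGroupType)
    (M : rgmodule R G) : Prop :=
  forall m : M, open [set g : G | rgmod_act g m = m].

Definition fin_gen (R : comPzRingType) (G : groupType) (M : rgmodule R G) :
    Prop :=
  exists (k : nat) (x : 'I_k -> M), forall m : M,
    exists (l : nat) (c : 'I_l -> R) (g : 'I_l -> G) (j : 'I_l -> 'I_k),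
      m = \sum_(i < l) c i *: rgmod_act (g i) (x (j i)).

Definition is_basis (R : comPzRingType) (M : lmodType R) (I : Type)
    (e : I -> M) : Prop :=
  (forall (k : nat) (s : 'I_k -> I) (c : 'I_k -> R), injective s ->
     \sum_(i < k) c i *: e (s i) = 0 -> forall i, c i = 0) /\
  (forall m : M, exists (k : nat) (s : 'I_k -> I) (c : 'I_k -> R),
     m = \sum_(i < k) c i *: e (s i)).

(* P is (isomorphic to) R[W]: the family e maps the G-set W equivariantly to
   an R-basis of P (over the zero ring e need not be injective). *)
Definition proper_discrete_permutation (R : comPzRingType)
    (G : topologicalGroupType) (P : rgmodule R G) : Prop :=
  exists (W : gset G) (e : W -> P),
    [/\ is_basis e,
        forall g w, e (gset_act g w) = rgmod_act g (e w)
      & forall w : W, compact [set g : G | gset_act g w = w] /\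
                      open [set g : G | gset_act g w = w]].

Record resolution (R : comPzRingType) (G : groupType) (M : rgmodule R G) :=
  Resolution {
    res_mod :> nat -> rgmodule R G ;
    res_diff : forall i, rghom (res_mod i.+1) (res_mod i) ;
    res_aug : rghom (res_mod 0%N) M ;
    res_aug_surj : range res_aug = [set: M] ;
    res_exact0 : exact_at (res_diff 0%N) res_aug ;
    res_exactS : forall i, exact_at (res_diff i.+1) (res_diff i)
  }.

Variant extnat := Fin of nat | Infty.

Definition le_extnat (i : nat) (n : extnat) : bool :=
  if n is Fin k then (i <= k)%N else true.

Definition type_FP (R : comPzRingType) (G : topologicalGroupType)
    (n : extnat) (M : rgmodule R G) : Prop :=
  exists P : resolution M,
    (forall i, proper_discrete_permutation (P i)) /\
    (forall i, le_extnat i n -> fin_gen (P i)).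

(* Type FP_{n-1}, where FP_{-1} is no condition and oo - 1 = oo. *)
Definition type_FP_pred (R : comPzRingType) (G : topologicalGroupType)
    (n : extnat) (M : rgmodule R G) : Prop :=
  match n with
  | Fin 0 => True
  | Fin k.+1 => type_FP (Fin k) M
  | Infty => type_FP Infty M
  end.

(* Main.v *)
Require Import Defs.
From HB Require Import structures.
From mathcomp Require Import all_boot all_algebra.
From mathcomp Require Import all_classical all_analysis.

Set Implicit Arguments.
Unset Strict Implicit.
Unset Printing Implicit Defensive.

(** Permutation modules on compact open stabilisers need not be projective, so the
comparison of two resolutions rests on a weaker lifting property. Let
[h : A -> B] be onto, with [A] discrete, and let [R[X] -> B] be a map from a
permutation module. Each [x] in [X] goes to some [h a]; the orbit of [(x, a)]
in [X * A] has the stabiliser [Stab x] intersected with [Stab a], which is again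
compact and open. Finitely many such orbits form a G-set [Q] over [X], with
finite fibres because [Stab x] is compact and acts on [a] with open
stabiliser, and [R[Q] -> R[X] -> B] lifts to [A] ([equivariant_lift_cover]).
The price is the kernel of [R[Q] -> R[X]]. It is of type FP_infty, since the
fibre powers of [Q] over [X] give a Cech complex of finitely generated proper
permutation modules that resolves it ([ker_permmod_map_fp]).

The finiteness condition is used in the recursive form [fp]: [fp 0] is no
condition, and [fp k.+1 M] says that some finitely generated proper permutation
module maps onto [M] with a kernel satisfying [fp k]. Thus [fp k] is
FP_(k-1). The three closure properties are proved for [fp].

- Extensions ([fp_ext]), by induction on the index: lift a cover of the
  quotient to the middle term and add a cover of the submodule; the kernel of
  the resulting cover is an extension of kernels of lower index.
- Quotients ([fp_quotient]): if [R[X]] covers [M] with kernel [K], then it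
  covers [M''] with a kernel that is an extension of [M'] by [K].
- Kernels ([fp_kernel]): lift a cover [R[Q] -> M''] to [psi : R[Q] -> M]. The
  sum of the inclusion and [psi] maps [M' (+) R[Q]] onto [M], and its kernel is
  the kernel of [R[Q] -> M'']. So [M' (+) R[Q]] is an extension, and [M'] is its
  quotient by [R[Q]].

It remains to pass between [fp] and resolutions ([type_FPP]). A resolution
gives [fp] by splitting off one kernel at a time. Conversely kernels are
covered repeatedly; under [forall k, fp k] this continues for ever, because
[fp_kernel] makes the kernel of any finitely generated cover satisfy all [fp k]
again. After the finitely generated range of a finite index, a kernel [K] is
covered by [R[X0 * K]], where [X0] is the G-set of the first cover, nonempty
unless [M] is zero: the first component makes the stabilisers compact, the
projection to [K] makes the map onto. *)

Import GRing.Theory.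
Local Open Scope classical_set_scope.
Local Open Scope ring_scope.

(** * Free modules as finitely supported functions *)

Section FinitelySupported.
Variables (R : comPzRingType) (X : Type).
Implicit Types (M N : lmodType R) (S : set X).

Definition fin_supp : {pred X -> R^o} :=
  fun f => `[< finite_set [set x | f x <> 0] >].

Lemma fin_supp_submod_closed : submod_closed fin_supp.
Proof.
split=> [|a f h /asboolP ff /asboolP fh]; apply/asboolP.
  by apply: (sub_finite_set _ (@finite_set0 X)) => x /=.
apply: (@sub_finite_set _ _ ([set x | f x <> 0] `|` [set x | h x <> 0])).
  move=> x /= ne0; have [fx0|] := pselect (f x = 0); last by left.
  by right=> hx0; apply: ne0; rewrite /= !fctE fx0 hx0 scaler0 addr0.
by rewrite finite_setU.
Qed.

HB.instance Definition _ :=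
  GRing.isSubmodClosed.Build R (X -> R^o) fin_supp fin_supp_submod_closed.

Record finfree := FinFree {
  finfree_val :> X -> R^o;
  finfree_prop : finfree_val \in fin_supp }.

HB.instance Definition _ := [isSub for finfree_val].
HB.instance Definition _ := [Choice of finfree by <:].
HB.instance Definition _ := [SubChoice_isSubLmodule of finfree by <:].

Lemma finfreeP (u v : finfree) : (forall x, u x = v x) -> u = v.
Proof. by move=> uv; apply/val_inj/funext. Qed.

Lemma finfree0E x : (0 : finfree) x = 0. Proof. by []. Qed.
Lemma finfreeDE (u v : finfree) x : (u + v) x = u x + v x. Proof. by []. Qed.
Lemma finfreeZE a (u : finfree) x : (a *: u) x = a * u x. Proof. by []. Qed.

Lemma finfree_sumE (I : Type) (s : seq I) (F : I -> finfree) x :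
  (\sum_(i <- s) F i) x = \sum_(i <- s) (F i x : R).
Proof.
elim: s => [|i s IHs]; first by rewrite !big_nil.
by rewrite !big_cons finfreeDE IHs.
Qed.

Lemma finfree_supp (u : finfree) :
  exists s : seq {classic X}, uniq s /\
    forall x : {classic X}, u x <> 0 -> x \in s.
Proof.
have /asboolP/(@finite_seqP {classic X})[s sE] := finfree_prop u.
exists (undup s); rewrite undup_uniq; split=> // x ux0.
by rewrite (@mem_undup {classic X}); suff : [set` s] x by []; rewrite -sE.
Qed.

Lemma delta_fin_supp (x : X) :
  (fun y => (`[< y = x >])%:R : R^o) \in fin_supp.
Proof.
apply/asboolP/(sub_finite_set _ (finite_set1 x)) => y /=.
by case: asboolP.
Qed.

Definition delta (x : X) : finfree := FinFree (delta_fin_supp x).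

Lemma deltaE x y : delta x y = (`[< y = x >])%:R. Proof. by []. Qed.

Section Lift.
Variables (M : lmodType R) (phi : X -> M).

(** The linear map that extends [phi]. The alias [{classic X}] gives [X] the
choice structure that finitely supported sums ask of their index type. *)
Definition linext (u : finfree) : M :=
  \sum_(x \in [set: {classic X}]) (u x : R) *: phi x.

Lemma linext_seq (u : finfree) (s : seq {classic X}) :
  uniq s -> (forall x : {classic X}, u x <> 0 -> x \in s) ->
  linext u = \sum_(x <- s) (u x : R) *: phi x.
Proof.
move=> us sP; rewrite /linext (fsbigE s)//=.
  by apply: eq_bigl => x; rewrite in_setT.
move=> x _ xs; have [->|/sP] := pselect (u x = 0); first by rewrite scale0r.
by rewrite (negbTE xs).
Qed.

Lemma linext_is_linear : linear linext.
Proof.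
move=> a u v; have [s [us sP]] := finfree_supp u.
have [t [ut tP]] := finfree_supp v.
have uw : uniq (undup (s ++ t)) by rewrite undup_uniq.
rewrite !(@linext_seq _ (undup (s ++ t)))//.
- rewrite scaler_sumr -big_split; apply: eq_bigr => x _.
  by rewrite finfreeDE finfreeZE scalerDl scalerA.
- by move=> x /tP xt; rewrite mem_undup mem_cat xt orbT.
- by move=> x /sP xs; rewrite mem_undup mem_cat xs.
- move=> x ne0; rewrite mem_undup mem_cat.
  have [ux0|/sP->//] := pselect (u x = 0).
  rewrite tP ?orbT// => vx0; apply: ne0.
  by rewrite finfreeDE finfreeZE ux0 vx0 mulr0 addr0.
Qed.

HB.instance Definition _ :=
  GRing.isLinear.Build R finfree M *:%R linext linext_is_linear.

Lemma linext_delta x : linext (delta x) = phi x.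
Proof.
rewrite (@linext_seq _ [:: (x : {classic X})])//.
  by rewrite big_seq1 deltaE asboolT// scale1r.
by move=> y; rewrite deltaE; case: asboolP => [->|]//; rewrite mem_head.
Qed.

End Lift.

Lemma linext_id u : linext delta u = u.
Proof.
have [s [us sP]] := finfree_supp u.
rewrite (linext_seq delta us sP); apply: finfreeP => y.
rewrite finfree_sumE.
have [ys|ys] := boolP ((y : {classic X}) \in s).
  rewrite (bigD1_seq (y : {classic X}))// finfreeZE deltaE asboolT// mulr1.
  rewrite big1; first exact: addr0.
  move=> x /eqP xy; rewrite finfreeZE deltaE asboolF ?mulr0// => yx.
  exact: xy.
rewrite big1_seq.
  by apply/esym; apply: contrapT => /sP; rewrite (negbTE ys).
move=> x /andP[_ xs]; rewrite finfreeZE deltaE asboolF ?mulr0// => yx.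
by move: ys; rewrite yx xs.
Qed.

Definition supported S (u : finfree) := forall x, u x <> 0 -> S x.

Lemma supported_ind S (Q : finfree -> Prop) :
  Q 0 -> (forall u v, Q u -> Q v -> Q (u + v)) ->
  (forall (a : R) u, Q u -> Q (a *: u)) ->
  (forall x, S x -> Q (delta x)) -> forall u, supported S u -> Q u.
Proof.
move=> Q0 QD QZ Qd u uS; have [s [us sP]] := finfree_supp u.
rewrite -(linext_id u) (linext_seq delta us sP).
elim: {us sP} s => [|x s IHs]; first by rewrite big_nil.
rewrite big_cons; apply: QD => //.
have [->|/uS Sx] := pselect (u x = 0); first by rewrite scale0r.
exact/QZ/Qd.
Qed.

Lemma finfree_ind (Q : finfree -> Prop) :
  Q 0 -> (forall u v, Q u -> Q v -> Q (u + v)) ->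
  (forall (a : R) u, Q u -> Q (a *: u)) ->
  (forall x, Q (delta x)) -> forall u, Q u.
Proof. by move=> Q0 QD QZ Qd u; apply: (@supported_ind setT) => // x. Qed.

Lemma supported_ext S M (p q : {linear finfree -> M}) :
  (forall x, S x -> p (delta x) = q (delta x)) ->
  forall u, supported S u -> p u = q u.
Proof.
move=> pq; apply: supported_ind => //; first by rewrite !linear0.
- by move=> u v pu pv; rewrite !linearD pu pv.
- by move=> a u pu; rewrite !linearZ pu.
Qed.

Lemma finfree_ext M (p q : {linear finfree -> M}) :
  (forall x, p (delta x) = q (delta x)) -> p =1 q.
Proof. by move=> pq u; apply: (@supported_ext setT) => // x. Qed.

End FinitelySupported.

Arguments finfree R X : clear implicits.
Arguments delta {R X} x.

Lemma supported_delta (R : comPzRingType) (X : Type) (S : set X) (x : X) :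
  S x -> supported S (delta x : finfree R X).
Proof. by move=> Sx y; rewrite deltaE; case: asboolP => [->|]. Qed.

Section SupportedClosure.
Variables (R : comPzRingType) (X : Type) (S : set X).
Implicit Types u v : finfree R X.

Lemma supported0 : supported S (0 : finfree R X).
Proof. by move=> x; rewrite finfree0E. Qed.

Lemma supportedD u v : supported S u -> supported S v -> supported S (u + v).
Proof.
move=> Su Sv x ne0; have [ux0|/Su//] := pselect (u x = 0).
by apply: Sv => vx0; apply: ne0; rewrite finfreeDE ux0 vx0 addr0.
Qed.

Lemma supportedZ (a : R) u : supported S u -> supported S (a *: u).
Proof.
move=> Su x ne0; apply: Su => ux0; apply: ne0.
by rewrite finfreeZE ux0 mulr0.
Qed.

Lemma supportedB u v : supported S u -> supported S v -> supported S (u - v).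
Proof. by move=> Su Sv; rewrite -scaleN1r; apply/supportedD/supportedZ. Qed.

Lemma supported_linext (Y : Type) (T : set Y) (phi : Y -> finfree R X) :
  (forall y, T y -> supported S (phi y)) ->
  forall w : finfree R Y, supported T w -> supported S (linext phi w).
Proof.
move=> phiS; apply: supported_ind.
- by rewrite linear0; exact: supported0.
- by move=> u v; rewrite linearD; exact: supportedD.
- by move=> a u; rewrite linearZ; exact: supportedZ.
- by move=> y Ty; rewrite linext_delta; exact: phiS.
Qed.

End SupportedClosure.

Section Pushforward.
Variables (R : comPzRingType) (X Y : Type) (f : X -> Y).

Definition push : finfree R X -> finfree R Y := linext (fun x => delta (f x)).
HB.instance Definition _ := GRing.Linear.on push.

(** A one-sided inverse of [push] that kills the basis elements outside the
range of [f]. It turns a support condition into membership in the image. *)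
Definition pull : finfree R Y -> finfree R X :=
  linext (fun y => if pselect (exists x, f x = y) is left fx
                   then delta (sval (cid fx)) else 0).
HB.instance Definition _ := GRing.Linear.on pull.

Lemma push_delta x : push (delta x) = delta (f x).
Proof. exact: linext_delta. Qed.

Lemma push_supported u : supported (range f) (push u).
Proof.
apply: (@supported_linext _ _ _ _ setT) => // x _.
by apply: supported_delta; exists x.
Qed.

Lemma pullK v : supported (range f) v -> push (pull v) = v.
Proof.
apply: (supported_ext (p := push \o pull) (q := idfun)) => _ [x _ <-] /=.
rewrite /pull linext_delta; case: pselect => [fx|nfx]; last first.
  by exfalso; apply: nfx; exists x.
by rewrite push_delta; case: cid => x' /= ->.
Qed.

Lemma pushK : injective f -> cancel push pull.
Proof.
move=> finj; apply: (finfree_ext (p := pull \o push) (q := idfun)) => x /=.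
rewrite push_delta /pull linext_delta; case: pselect => [fx|[]].
  by case: cid => y /= /finj ->.
by exists x.
Qed.

Lemma push_inj : injective f -> injective push.
Proof. by move=> /pushK; exact: can_inj. Qed.

Lemma push_surj :
  (forall y, exists x, f x = y) -> forall v, exists u, push u = v.
Proof.
move=> fsurj v; exists (pull v); apply: pullK => y _.
by have [x fx] := fsurj y; exists x.
Qed.

End Pushforward.

(** * G-sets and their orbits *)

Section GsetConstructions.
Variable G : groupType.
Implicit Types X Y : gset G.

Program Definition gprod X Y : gset G :=
  @GSet G (X * Y)%type (fun g p => (gset_act g p.1, gset_act g p.2)) _ _.
Next Obligation. by move=> X Y [x y]; rewrite !gset_act1. Qed.
Next Obligation. by move=> X Y g h [x y]; rewrite !gset_actM. Qed.

Program Definition gsum X Y : gset G :=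
  @GSet G (X + Y)%type (fun g s => match s with
    inl x => inl (gset_act g x) | inr y => inr (gset_act g y) end) _ _.
Next Obligation. by move=> X Y [x|y] /=; rewrite gset_act1. Qed.
Next Obligation. by move=> X Y g h [x|y] /=; rewrite gset_actM. Qed.

Program Definition gseq X : gset G :=
  @GSet G (seq X) (fun g => map (gset_act g)) _ _.
Next Obligation. by move=> X; elim=> //= x s ->; rewrite gset_act1. Qed.
Next Obligation.
by move=> X g h; elim=> //= x s ->; rewrite gset_actM.
Qed.

Program Definition gempty : gset G :=
  @GSet G Empty_set (fun _ x => x) _ _.
Next Obligation. by []. Qed.
Next Obligation. by []. Qed.

Definition ginvariant X (S : set X) := forall g x, S x -> S (gset_act g x).

Program Definition gsub X (S : set X) (invS : ginvariant S) : gset G :=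
  @GSet G {x | S x} (fun g x => exist _ (gset_act g (sval x)) _) _ _.
Next Obligation. by move=> X S invS g [x Sx]; exact: invS. Qed.
Next Obligation. by move=> X S invS [x Sx]; apply/eq_exist/gset_act1. Qed.
Next Obligation. by move=> X S invS g h [x Sx]; apply/eq_exist/gset_actM. Qed.

Lemma gset_actVK X g : cancel (@gset_act G X g) (gset_act g^-1%g).
Proof. by move=> x; rewrite -gset_actM mulVg gset_act1. Qed.

Definition gequivariant X Y (f : X -> Y) :=
  forall g x, f (gset_act g x) = gset_act g (f x).

Definition gfinite X := exists2 S : set X, finite_set S &
  forall x, exists g s, S s /\ x = gset_act g s.

Lemma gfinite_sum X Y : gfinite X -> gfinite Y -> gfinite (gsum X Y).
Proof.
move=> [S Sfin SX] [T Tfin TY].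
exists ((inl @` S) `|` (inr @` T)).
  by rewrite finite_setU; split; exact: finite_image.
move=> [x|y].
  have [g [s [Ss ->]]] := SX x; exists g, (inl s); split=> //.
  by left; exists s.
have [g [s [Ss ->]]] := TY y; exists g, (inr s); split=> //.
by right; exists s.
Qed.

Lemma gfinite_empty : gfinite gempty.
Proof. by exists set0 => // -[]. Qed.

(** Every orbit of [Y] meets the fibre over one of the finitely many orbit
representatives of [X]. *)
Lemma gfinite_fibres X Y (f : Y -> X) : gequivariant f -> gfinite X ->
  (forall x, finite_set [set y | f y = x]) -> gfinite Y.
Proof.
move=> fE [S Sfin SX] ffin; exists (\bigcup_(x in S) [set y | f y = x]).
  by apply: bigcup_finite => // x _; exact: ffin.
move=> y; have [g [s [Ss fy]]] := SX (f y).
exists g, (gset_act g^-1%g y); split.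
  by exists s => //=; rewrite fE fy gset_actVK.
by rewrite -gset_actM mulgV gset_act1.
Qed.

End GsetConstructions.

(** * Stabilisers in a topological group *)

Section TopologicalGroup.
Variable G : topologicalGroupType.
Implicit Types X Y : gset G.

Lemma mulg_left_continuous (a : G) : continuous (fun h : G => (a * h)%g).
Proof.
move=> h.
have pc : (fun h : G => (a, h)) @ h --> (a, h).
  by apply: cvg_pair; [exact: cvg_cst | exact: cvg_id].
exact: (cvg_comp _ _ pc (@mulg_continuous G (a, h))).
Qed.

Definition gdiscrete X := forall x : X, open [set g | gset_act g x = x].

(** The stabiliser condition on a basis of a proper discrete permutation
module. *)
Definition gproper X := forall x : X,
  compact [set g | gset_act g x = x] /\ open [set g | gset_act g x = x].

Lemma gproper_discrete X : gproper X -> gdiscrete X.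
Proof. by move=> Xp x; have [] := Xp x. Qed.

(** Near any [g] with [g x = y] the transporter contains the translate by [g] of
a neighbourhood of 1 in the stabiliser. Requiring only such a neighbourhood
gives, for [y = x], that a stabiliser is open once it is a neighbourhood
of 1. *)
Lemma transporter_open X (x y : X) :
  nbhs (1%g : G) [set g | gset_act g x = x] -> open [set g | gset_act g x = y].
Proof.
move=> x1; rewrite openE /= => g gxy; rewrite /interior /=.
have := @mulg_left_continuous g^-1%g g; rewrite /continuous_at mulVg.
move=> /(_ _ x1) gx1; apply: (@filterS G (nbhs g) _ _ _ _ gx1) => h /= ghx.
by rewrite -gxy -[in RHS]ghx -gset_actM mulgA mulgV mul1g.
Qed.

Lemma gdiscrete_nbhs1 X :
  (forall x : X, nbhs (1%g : G) [set g | gset_act g x = x]) -> gdiscrete X.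
Proof. by move=> X1 x; exact: transporter_open. Qed.

Lemma stab_nbhs1 X (x : X) : open [set g | gset_act g x = x] ->
  nbhs (1%g : G) [set g | gset_act g x = x].
Proof. by move=> xo; apply: open_nbhs_nbhs; split=> //=; exact: gset_act1. Qed.

(** The complement is a union of transporters, which are open. *)
Lemma stab_closed X (x : X) : open [set g | gset_act g x = x] ->
  closed [set g | gset_act g x = x].
Proof.
move=> /stab_nbhs1 x1; rewrite -openC.
rewrite (_ : ~` _ = \bigcup_(y in [set y | y <> x]) [set g | gset_act g x = y]).
  by apply: bigcup_open => y _; exact: transporter_open.
apply/seteqP; split=> [g /= gx|g [y /= yx gx]]; last by rewrite /= gx.
by exists (gset_act g x).
Qed.

Lemma transporter_compact X (x y : X) : compact [set g | gset_act g x = x] ->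
  compact [set g | gset_act g x = y].
Proof.
move=> xc; have [[a axy]|none] := pselect (exists a, gset_act a x = y).
  rewrite (_ : [set _ | _] =
      [set (a * h)%g | h in [set g | gset_act g x = x]]).
    apply: continuous_compact => //.
    exact/continuous_subspaceT/mulg_left_continuous.
  apply/seteqP; split=> [g /= gx|g /= [h hx <-]]; last by rewrite gset_actM hx.
  exists (a^-1 * g)%g; last by rewrite mulgA mulgV mul1g.
  by rewrite gset_actM gx -axy gset_actVK.
rewrite (_ : [set _ | _] = set0); first exact: compact0.
by apply/seteqP; split=> // g /= gx; apply: none; exists g.
Qed.

(** If the image were infinite, the sets [B] such that [f] takes finitely many
values on [K] minus [B] would form a proper filter on [K]. At a cluster point
[a] this filter contains [K] minus the open fibre of [f a], a contradiction. *)
Lemma finite_image_locally_constant (K : set G) (Y : Type) (f : G -> Y) :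
  compact K -> (forall g, open [set h | f h = f g]) -> finite_set (f @` K).
Proof.
move=> Kc fo; apply: contrapT => fKinf.
pose F := [set B : set G | finite_set (f @` (K `\` B))].
have FF : ProperFilter F.
  split; first by rewrite /F /= setD0.
  split; rewrite /F.
  - by rewrite /mkset setDT image_set0.
  - by move=> B C FB FC; rewrite /mkset setDIr image_setU finite_setU.
  - move=> B C BC; apply: sub_finite_set; apply: image_subset.
    exact: setDS.
have FK : F K by rewrite /F /= setDv image_set0.
have [a [Ka]] := Kc F FF FK.
have Fa : F (K `\` [set h | f h = f a]).
  apply: (sub_finite_set _ (finite_set1 (f a))) => _ [h [Kh nh] <-] /=.
  by apply: contrapT => hh; apply: nh.
move=> /(_ _ [set h | f h = f a] Fa) [].
  by apply: open_nbhs_nbhs; split=> //=; exact: fo.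
by move=> h [[_ ?]].
Qed.

(** The stabiliser of a pair is closed in that of its first component, hence
compact. *)
Lemma gproper_prod X Y : gproper X -> gdiscrete Y -> gproper (gprod X Y).
Proof.
move=> Xp Yd [x y]; have [xc xo] := Xp x.
rewrite (_ : [set _ | _] = [set g | gset_act g x = x] `&`
    [set g | gset_act g y = y]).
  split; last exact: openI.
  by apply: compact_closedI => //; exact: stab_closed.
by apply/seteqP; split=> g /= => [[? ?]|[-> ->]].
Qed.

Lemma gproper_sum X Y : gproper X -> gproper Y -> gproper (gsum X Y).
Proof.
move=> Xp Yp [x|y].
- rewrite (_ : [set _ | _] = [set g | gset_act g x = x]); first exact: Xp.
  by apply/seteqP; split=> g /= => [[]|->].
- rewrite (_ : [set _ | _] = [set g | gset_act g y = y]); first exact: Yp.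
  by apply/seteqP; split=> g /= => [[]|->].
Qed.

Lemma gproper_sub X (S : set X) (invS : ginvariant S) :
  gproper X -> gproper (gsub invS).
Proof.
move=> Xp [x Sx].
rewrite (_ : [set _ | _] = [set g | gset_act g x = x]); first exact: Xp.
by apply/seteqP; split=> g /= => [[]|gx]//; exact: eq_exist.
Qed.

Lemma gproper_empty : gproper (gempty G). Proof. by case. Qed.

Lemma gdiscrete_seq X : gdiscrete X -> gdiscrete (gseq X).
Proof.
move=> Xd; apply: gdiscrete_nbhs1; elim=> [|x s IHs] /=.
  by rewrite (_ : [set _ | _] = setT); [exact: filterT|exact/seteqP].
by near=> g; congr cons; near: g => //; exact/stab_nbhs1/Xd.
Unshelve. all: by end_near. Qed.

End TopologicalGroup.

(** * Kernels, sums and exact sequences *)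

Section ModuleConstructions.
Variables (R : comPzRingType) (G : groupType).
Implicit Types K L M N : rgmodule R G.

Section Build.
Variables (M N : rgmodule R G) (f : M -> N).
Hypotheses (f_lin : linear f)
  (f_act : forall g m, f (rgmod_act g m) = rgmod_act g (f m)).
Let f_linear : {linear M -> N} :=
  HB.pack f (GRing.isLinear.Build R M N *:%R f f_lin).
Definition rghom_of : rghom M N := @RGHom R G M N f_linear f_act.
End Build.

Definition rgcomp L M N (f : rghom M N) (h : rghom L M) : rghom L N :=
  @RGHom R G L N (f \o h : {linear L -> N})
    (fun g m => etrans (congr1 f (rghom_act h g m)) (rghom_act f g (h m))).

Lemma rghom_inverse M N (f : rghom M N) : injective f ->
  (forall n, exists m, f m = n) ->
  exists h : rghom N M, cancel f h /\ cancel h f.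
Proof.
move=> finj /choice[h fh].
have hf m : h (f m) = m by apply: finj; rewrite fh.
have h_lin : linear h.
  by move=> a u v; apply: finj; rewrite linearP !fh.
have h_act g m : h (rgmod_act g m) = rgmod_act g (h m).
  by apply: finj; rewrite rghom_act !fh.
by exists (rghom_of h_lin h_act).
Qed.

Section Kernel.
Variables (M N : rgmodule R G) (f : rghom M N).

Definition rgker_pred : {pred M} := fun m => `[< f m = 0 >].

Lemma rgker_submod_closed : submod_closed rgker_pred.
Proof.
split=> [|a u v /asboolP fu /asboolP fv]; apply/asboolP; first exact: linear0.
by rewrite linearP fu fv scaler0 addr0.
Qed.

HB.instance Definition _ :=
  GRing.isSubmodClosed.Build R M rgker_pred rgker_submod_closed.

Record rgker_car := RGKer {
  rgker_val : M;
  rgker_prop : rgker_val \in rgker_pred }.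

HB.instance Definition _ := [isSub for rgker_val].
HB.instance Definition _ := [Choice of rgker_car by <:].
HB.instance Definition _ := [SubChoice_isSubLmodule of rgker_car by <:].

Lemma rgker_act_subproof g (k : rgker_car) :
  rgmod_act g (rgker_val k) \in rgker_pred.
Proof.
by apply/asboolP; case: k => k /= /asboolP fk; rewrite rghom_act fk linear0.
Qed.

Definition rgker_act g k : rgker_car := RGKer (rgker_act_subproof g k).

Lemma rgker_act_linear g : linear (rgker_act g).
Proof. by move=> a u v; apply: val_inj; rewrite /= linearP. Qed.

HB.instance Definition _ g :=
  GRing.isLinear.Build R rgker_car rgker_car *:%R (rgker_act g)
    (rgker_act_linear g).

Lemma rgker_act1 k : rgker_act 1%g k = k.
Proof. by apply: val_inj; rewrite /= rgmod_act1. Qed.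

Lemma rgker_actM g h k : rgker_act (g * h)%g k = rgker_act g (rgker_act h k).
Proof. by apply: val_inj; rewrite /= rgmod_actM. Qed.

Definition rgker : rgmodule R G :=
  @RGModule R G rgker_car (fun g => rgker_act g) rgker_act1 rgker_actM.

Lemma rgker_val_linear : linear (rgker_val : rgker -> M). Proof. by []. Qed.

Definition rgker_incl : rghom rgker M :=
  rghom_of rgker_val_linear (fun g k => erefl).

Lemma rgker_incl_inj : injective rgker_incl.
Proof. exact: val_inj. Qed.

Lemma rgker_incl0 k : f (rgker_incl k) = 0.
Proof. by case: k => k /= /asboolP. Qed.

Lemma rgker_inclP m : f m = 0 -> exists k, rgker_incl k = m.
Proof. by move=> /asboolP fm; exists (RGKer fm). Qed.

Section Corestrict.
Variables (L : rgmodule R G) (h : rghom L M) (h0 : forall x, f (h x) = 0).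

Definition rgker_lift_fun (x : L) : rgker :=
  RGKer (introT (asboolP _) (h0 x) : h x \in rgker_pred).

Lemma rgker_lift_linear : linear rgker_lift_fun.
Proof. by move=> a u v; apply: val_inj; rewrite /= linearP. Qed.

Lemma rgker_lift_act g x :
  rgker_lift_fun (rgmod_act g x) = rgmod_act g (rgker_lift_fun x).
Proof. by apply: val_inj; rewrite /= rghom_act. Qed.

Definition rgker_lift : rghom L rgker :=
  rghom_of rgker_lift_linear rgker_lift_act.

Lemma rgker_liftK x : rgker_incl (rgker_lift x) = h x. Proof. by []. Qed.

End Corestrict.
End Kernel.

Section DirectSum.
Variables M N : rgmodule R G.

Definition rgsum_act g (p : M * N) : M * N :=
  (rgmod_act g p.1, rgmod_act g p.2).

Lemma rgsum_act_linear g : linear (rgsum_act g).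
Proof. by move=> a u v; rewrite /rgsum_act /= !linearP. Qed.

HB.instance Definition _ g :=
  GRing.isLinear.Build R (M * N)%type (M * N)%type *:%R (rgsum_act g)
    (rgsum_act_linear g).

Lemma rgsum_act1 p : rgsum_act 1%g p = p.
Proof. by case: p => m n; rewrite /rgsum_act !rgmod_act1. Qed.

Lemma rgsum_actM g h p : rgsum_act (g * h)%g p = rgsum_act g (rgsum_act h p).
Proof. by rewrite /rgsum_act !rgmod_actM. Qed.

Definition rgsum : rgmodule R G :=
  @RGModule R G (M * N)%type (fun g => rgsum_act g) rgsum_act1 rgsum_actM.
End DirectSum.

Lemma exact_atP L M N (f : rghom L M) (h : rghom M N) : exact_at f h <->
  (forall x, h (f x) = 0) /\ (forall m, h m = 0 -> exists x, f x = m).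
Proof.
split=> [fh|[hf fh]].
  split=> [x|m hm].
    by have : [set m | h m = 0] (f x) by rewrite -fh; exists x.
  have [x _ fx] : range f m by rewrite fh; exact: hm.
  by exists x.
apply/seteqP; split=> [_ [x _ <-]|m /fh[x <-]]; first exact: hf.
by exists x.
Qed.

Lemma short_exactP L M N (f : rghom L M) (h : rghom M N) :
  short_exact f h <->
  [/\ injective f, forall x, h (f x) = 0,
      forall m, h m = 0 -> exists x, f x = m & forall z, exists m, h m = z].
Proof.
split=> [[finj /exact_atP[hf fh] hsurj]|[finj hf fh hsurj]].
  split=> // z; have [m _ hm] : range h z by rewrite hsurj.
  by exists m.
split=> //; first exact/exact_atP.
by apply/seteqP; split=> // z _; have [m <-] := hsurj z; exists m.
Qed.

Lemma short_exact_ker M N (f : rghom M N) : (forall z, exists m, f m = z) ->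
  short_exact (rgker_incl f) f.
Proof.
move=> fsurj; apply/short_exactP; split=> //.
- exact: rgker_incl_inj.
- exact: rgker_incl0.
- exact: rgker_inclP.
Qed.

(** The kernel part of the snake lemma for a composite [w = v u] with [u] onto:
the sequence [0 -> ker u -> ker w -> ker v -> 0] is exact. The map [w] is
kept separate because the composite may be presented in another way. *)
Lemma short_exact_ker_comp A B C (u : rghom A B) (v : rghom B C)
    (w : rghom A C) : (forall x, w x = v (u x)) ->
  (forall b, exists a, u a = b) ->
  exists (i : rghom (rgker u) (rgker w)) (p : rghom (rgker w) (rgker v)),
    short_exact i p.
Proof.
move=> wE usurj.
have i0 x : w (rgker_incl u x) = 0 by rewrite wE rgker_incl0 linear0.
have p0 x : v (rgcomp u (rgker_incl w) x) = 0.
  by rewrite -[LHS]wE rgker_incl0.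
exists (rgker_lift i0), (rgker_lift p0); apply/short_exactP; split.
- move=> x y /(congr1 (rgker_incl _)); rewrite !rgker_liftK.
  exact: rgker_incl_inj.
- move=> x; apply: rgker_incl_inj; rewrite rgker_liftK linear0.
  exact: (rgker_incl0 x).
- move=> x /(congr1 (rgker_incl _)); rewrite rgker_liftK linear0 => ux.
  have /rgker_inclP[y yx] : u (rgker_incl w x) = 0 by exact: ux.
  by exists y; apply: rgker_incl_inj; rewrite rgker_liftK.
- move=> z; have [x xz] := usurj (rgker_incl v z).
  have /rgker_inclP[y yx] : w x = 0 by rewrite wE xz rgker_incl0.
  by exists y; apply: rgker_incl_inj; rewrite rgker_liftK -xz -yx.
Qed.

End ModuleConstructions.

(** * Permutation modules *)

Section PermutationModule.
Variables (R : comPzRingType) (G : groupType) (X : gset G).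
Implicit Types M N : rgmodule R G.

Definition permmod_act (g : G) : finfree R X -> finfree R X :=
  linext (fun x => delta (gset_act g x)).

HB.instance Definition _ g := GRing.Linear.on (permmod_act g).

Lemma permmod_act_delta g x : permmod_act g (delta x) = delta (gset_act g x).
Proof. exact: linext_delta. Qed.

Lemma permmod_act1 u : permmod_act 1%g u = u.
Proof.
apply: (finfree_ext (p := permmod_act 1%g) (q := idfun)) => x /=.
by rewrite permmod_act_delta gset_act1.
Qed.

Lemma permmod_actM g h u :
  permmod_act (g * h)%g u = permmod_act g (permmod_act h u).
Proof.
apply: (finfree_ext (p := permmod_act (g * h)%g)
  (q := permmod_act g \o permmod_act h)) => x /=.
by rewrite !permmod_act_delta gset_actM.
Qed.

Definition permmod : rgmodule R G :=
  @RGModule R G (finfree R X) (fun g => permmod_act g)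
    permmod_act1 permmod_actM.

Lemma permmod_linext_act M (phi : X -> M) :
  (forall g x, phi (gset_act g x) = rgmod_act g (phi x)) ->
  forall g (u : permmod),
    linext phi (rgmod_act g u) = rgmod_act g (linext phi u).
Proof.
move=> phi_act g u.
apply: (finfree_ext (p := linext phi \o permmod_act g)
  (q := rgmod_act g \o linext phi)) => x.
by rewrite /= permmod_act_delta !linext_delta phi_act.
Qed.

Definition permmod_hom M (phi : X -> M)
    (phi_act : forall g x, phi (gset_act g x) = rgmod_act g (phi x)) :
    rghom permmod M :=
  @RGHom R G permmod M (linext phi : {linear finfree R X -> M})
    (permmod_linext_act phi_act).

End PermutationModule.

Arguments permmod R {G} X.

Section PermutationMap.
Variables (R : comPzRingType) (G : groupType) (X Y : gset G) (f : X -> Y).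
Hypothesis fE : gequivariant f.

Lemma permmod_map_subproof g x : (delta (f (gset_act g x)) : permmod R Y) =
  rgmod_act g (delta (f x) : permmod R Y).
Proof. by rewrite fE -permmod_act_delta. Qed.

Definition permmod_map : rghom (permmod R X) (permmod R Y) :=
  permmod_hom (phi := fun x => delta (f x) : permmod R Y) permmod_map_subproof.

Lemma permmod_map_delta x : permmod_map (delta x) = delta (f x).
Proof. exact: linext_delta. Qed.

End PermutationMap.
Arguments permmod_map R {G X Y f} fE.

(** * Discrete modules and the lifting of covers *)

Section Discreteness.
Variables (R : comPzRingType) (G : topologicalGroupType).
Implicit Types M N : rgmodule R G.

(** [discrete_module M] unfolds to [gdiscrete (gmod M)], so the facts on
stabilisers in G-sets apply to modules. *)
Definition gmod M : gset G :=
  @GSet G M (fun g => rgmod_act g) (@rgmod_act1 R G M) (@rgmod_actM R G M).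

Lemma discrete_inj M N (f : rghom M N) : injective f ->
  discrete_module N -> discrete_module M.
Proof.
move=> finj Nd m; rewrite (_ : [set _ | _] = [set g | rgmod_act g (f m) = f m]).
  exact: Nd.
apply/seteqP; split=> g /= gm; first by rewrite -rghom_act gm.
by apply: finj; rewrite rghom_act.
Qed.

Lemma discrete_ker M N (f : rghom M N) :
  discrete_module M -> discrete_module (rgker f).
Proof. exact/discrete_inj/rgker_incl_inj. Qed.

(** The stabiliser of [u] contains the intersection of the stabilisers of the
finitely many points of its support. *)
Lemma discrete_permmod (X : gset G) :
  gdiscrete X -> discrete_module (permmod R X).
Proof.
move=> Xd; apply: (@gdiscrete_nbhs1 G (gmod (permmod R X))); rewrite /=.
apply: finfree_ind => [|u v u1 v1|a u u1|x].
- by apply: filterE => g; exact: linear0.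
- apply: (@filterS2 _ _ _ _ _ _ _ u1 v1) => g gu gv.
  by apply: (etrans (linearD _ _ _)); congr (_ + _).
- apply: (@filterS _ _ _ _ _ _ u1) => g gu.
  by apply: (etrans (linearZ_LR _ _ _)); congr (_ *: _).
- have /stab_nbhs1 := Xd x; apply: filterS => g /= gx.
  by rewrite -[LHS]/(permmod_act g (delta x)) permmod_act_delta gx.
Qed.

Lemma discrete_sum M N : discrete_module M -> discrete_module N ->
  discrete_module (rgsum M N).
Proof.
move=> Md Nd [m n].
rewrite (_ : [set _ | _] = [set g | rgmod_act g m = m] `&`
   [set g | rgmod_act g n = n]); first exact: openI.
by apply/seteqP; split=> g /= => [[? ?]|[gm gn]] //; rewrite /rgsum_act gm gn.
Qed.

End Discreteness.

Section Cover.
Variables (R : comPzRingType) (G : topologicalGroupType).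

(** The substitute for projectivity of [R[X]]. Lift the images of orbit
representatives [s] to elements [l s] of [A], and let [Q] be the union of the
orbits of the pairs [(s, l s)] in [X * A]; the two projections are [pi] and
[psi]. Each representative contributes finitely many points to the fibre over
[x]: the elements of [G] carrying [s] to [x] form a compact set, on which
[g |-> g (l s)] is locally constant. *)
Lemma equivariant_lift_cover (A B : rgmodule R G) (h : rghom A B) (X : gset G)
    (phi : X -> B) :
  (forall b, exists a, h a = b) -> discrete_module A ->
  gproper X -> gfinite X ->
  (forall g x, phi (gset_act g x) = rgmod_act g (phi x)) ->
  exists (Q : gset G) (pi : Q -> X) (psi : Q -> A),
    [/\ gproper Q, gequivariant pi,
        forall g q, psi (gset_act g q) = rgmod_act g (psi q) &
        [/\ forall q, h (psi q) = phi (pi q), forall x, exists q, pi q = x &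
        forall x, finite_set [set q | pi q = x]]].
Proof.
move=> hsurj Ad Xp [S Sfin SX] phi_act.
have /choice[l hl] : forall x, exists a, h a = phi x.
  by move=> x; exact: hsurj.
pose T : set (gprod X (gmod A)) := [set p | exists g s, S s /\
  p = @gset_act G (gprod X (gmod A)) g (s, l s)].
have invT : ginvariant T.
  by move=> g _ [g' [s [Ss ->]]]; exists (g * g')%g, s; rewrite gset_actM.
exists (gsub invT), (fun q => (sval q).1), (fun q => (sval q).2); split.
- exact/gproper_sub/gproper_prod.
- by [].
- by [].
split.
- case=> p Tp /=; have [g [s [_ ->]]] := Tp.
  by rewrite /= rghom_act hl phi_act.
- move=> x; have [g [s [Ss ->]]] := SX x.
  have Tq : T (@gset_act G (gprod X (gmod A)) g (s, l s)) by exists g, s.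
  by exists (exist _ _ Tq).
- move=> x.
  pose F := \bigcup_(s in S) ((fun g => (x, rgmod_act g (l s))) @`
    [set g | gset_act g s = x]).
  have Ffin : finite_set F.
    apply: bigcup_finite => // s Ss; apply: finite_image_locally_constant.
      by apply: transporter_compact; have [] := Xp s.
    move=> g; rewrite (_ : [set _ | _] =
        [set h | @gset_act G (gmod A) h (l s) = rgmod_act g (l s)]).
      exact/transporter_open/stab_nbhs1/(Ad (l s)).
    by apply/seteqP; split=> g' /= => [[]|->].
  apply: (sub_finite_set _ (finite_preimage (f := @sval _ T) _ Ffin)).
    move=> [p Tp] /= px; have [g [s [Ss pE]]] := Tp; exists s => //.
    by exists g => /=; rewrite -?px pE.
  by move=> [p Tp] [p' Tp'] _ _ /= pp'; exact: eq_exist.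
Qed.

End Cover.

(** * Recursive finiteness types *)

Section FiniteType.
Variables (R : comPzRingType) (G : topologicalGroupType).
Implicit Types K L M N : rgmodule R G.

(** The index is shifted: [fp k] stands for type FP_(k-1), so that [fp 0] is no
condition. *)
Fixpoint fp (k : nat) (M : rgmodule R G) : Prop :=
  if k is k'.+1 then
    exists (X : gset G) (K : rgmodule R G) (i : rghom K (permmod R X))
        (p : rghom (permmod R X) M),
      [/\ gproper X, gfinite X, short_exact i p & fp k' K]
  else True.

Lemma fp_iso k M N (f : rghom M N) : injective f ->
  (forall n, exists m, f m = n) -> fp k M -> fp k N.
Proof.
case: k => //= k finj fsurj [X [K [i [p [Xp Xf ex Kk]]]]].
have /short_exactP[iinj pi ip psurj] := ex.
exists X, K, i, (rgcomp f p); split=> //; apply/short_exactP; split=> //=.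
- by move=> x; rewrite pi linear0.
- by move=> x fpx; apply: ip; apply: finj; rewrite fpx linear0.
- move=> n; have [m <-] := fsurj n; have [x <-] := psurj m.
  by exists x.
Qed.

Lemma fp_trivial k M : (forall m : M, m = 0) -> fp k M.
Proof.
elim: k M => //= k IHk M M0.
have zero_act g (x : gempty G) : (0 : M) = rgmod_act g 0 by rewrite linear0.
exists (gempty G).
pose p := permmod_hom (phi := fun _ : gempty G => 0 : M) zero_act.
exists (rgker p), (rgker_incl p), p; split.
- exact: gproper_empty.
- exact: gfinite_empty.
- by apply: short_exact_ker => m; exists 0; rewrite [RHS]M0 [LHS]M0.
- by apply: IHk => -[u Ku]; apply: val_inj; apply: finfreeP => -[].
Qed.

(** The identity is a cover with zero kernel. *)
Lemma fp_permmod k X : gproper X -> gfinite X -> fp k (permmod R X).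
Proof.
case: k => //= k Xp Xf.
have idE : gequivariant (idfun : X -> X) by [].
have idI : injective (permmod_map R idE) by apply: push_inj.
exists X, (rgker (permmod_map R idE)), (rgker_incl _), (permmod_map R idE).
split=> //.
  by apply: short_exact_ker; apply: push_surj => x; exists x.
apply: fp_trivial => u; apply: rgker_incl_inj; apply: idI.
by rewrite rgker_incl0 linear0.
Qed.

End FiniteType.

(** * The Cech resolution of a map with finite fibres *)

Section Cech.
Variables (R : comPzRingType) (G : topologicalGroupType) (X Q : gset G).
Variable pi : Q -> X.
Hypotheses (piE : gequivariant pi) (Xp : gproper X) (Xf : gfinite X)
  (Qd : gdiscrete Q) (pi_surj : forall x, exists q, pi q = x)
  (pi_fin : forall x, finite_set [set q | pi q = x]).

Local Notation FR := (permmod R (gseq Q)).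
Local Notation T := (gprod X (gseq Q)).
Local Notation FT := (permmod R T).

(** The boundary is first defined on all finite sequences in [Q], by the cone
formula [seq_bd (q :: t) = t - q :: seq_bd t]. This is the alternating sum of
faces, augmented: the boundary of a singleton is the empty sequence. Unlike
the sum over faces, the recursion gives [seq_bd_seq_bd] at once from
[seq_bd_cone]. *)
Definition cone (q : Q) : FR -> FR := linext (fun t => delta (q :: t) : FR).
HB.instance Definition _ q := GRing.Linear.on (cone q).

Lemma cone_delta q t : cone q (delta t) = delta (q :: t).
Proof. exact: linext_delta. Qed.

Fixpoint seq_bd_fun (t : seq Q) : FR :=
  if t is q :: t' then delta t' - cone q (seq_bd_fun t') else 0.

Definition seq_bd : FR -> FR := linext seq_bd_fun.
HB.instance Definition _ := GRing.Linear.on seq_bd.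

Lemma seq_bd_delta t : seq_bd (delta t) = seq_bd_fun t.
Proof. exact: linext_delta. Qed.

Lemma seq_bd_cone q u : seq_bd (cone q u) = u - cone q (seq_bd u).
Proof.
apply: (finfree_ext (p := seq_bd \o cone q)
  (q := idfun \- (cone q \o seq_bd))) => t /=.
by rewrite cone_delta !seq_bd_delta.
Qed.

Lemma seq_bd_bd u : seq_bd (seq_bd u) = 0.
Proof.
apply: (finfree_ext (p := seq_bd \o seq_bd) (q := \0)) => t /=.
rewrite seq_bd_delta; elim: t => [|q t IHt] /=; first exact: linear0.
rewrite linearB /= seq_bd_cone IHt linear0 subr0.
by rewrite seq_bd_delta subrr.
Qed.

(** The complex needed lives on pairs of a base point and a sequence above it;
[over_pt w] places a chain of sequences over [w]. *)
Definition over_pt (w : X) : FR -> FT := linext (fun t => delta (w, t) : FT).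
HB.instance Definition _ w := GRing.Linear.on (over_pt w).

Lemma over_pt_delta w t : over_pt w (delta t) = delta (w, t).
Proof. exact: linext_delta. Qed.

Definition cech_bd_fun (p : T) : FT := over_pt p.1 (seq_bd_fun p.2).

Definition cech_bd : FT -> FT := linext cech_bd_fun.
HB.instance Definition _ := GRing.Linear.on cech_bd.

Lemma cech_bd_delta p : cech_bd (delta p) = cech_bd_fun p.
Proof. exact: linext_delta. Qed.

Lemma cech_bd_over w u : cech_bd (over_pt w u) = over_pt w (seq_bd u).
Proof.
apply: (finfree_ext (p := cech_bd \o over_pt w)
  (q := over_pt w \o seq_bd)) => t /=.
by rewrite over_pt_delta seq_bd_delta cech_bd_delta.
Qed.

Lemma cech_bd_bd u : cech_bd (cech_bd u) = 0.
Proof.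
apply: (finfree_ext (p := cech_bd \o cech_bd) (q := \0)) => -[w t] /=.
rewrite cech_bd_delta /cech_bd_fun /= cech_bd_over -seq_bd_delta.
by rewrite seq_bd_bd linear0.
Qed.

Definition fibre_section : X -> Q := fun x => sval (cid (pi_surj x)).

Lemma fibre_sectionK x : pi (fibre_section x) = x.
Proof. by rewrite /fibre_section; case: cid. Qed.

(** The section of [pi] need not be equivariant, so this homotopy is only linear;
that suffices for exactness. *)
Definition cech_homotopy : FT -> FT :=
  linext (fun p : T => delta (p.1, fibre_section p.1 :: p.2) : FT).
HB.instance Definition _ := GRing.Linear.on cech_homotopy.

Lemma cech_homotopy_delta p :
  cech_homotopy (delta p) = delta (p.1, fibre_section p.1 :: p.2).
Proof. exact: linext_delta. Qed.

Lemma cech_homotopy_over w u :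
  cech_homotopy (over_pt w u) = over_pt w (cone (fibre_section w) u).
Proof.
apply: (finfree_ext (p := cech_homotopy \o over_pt w)
  (q := over_pt w \o cone (fibre_section w))) => t /=.
by rewrite cone_delta !over_pt_delta cech_homotopy_delta.
Qed.

(** Prepending the chosen point over [w] is a cone construction, and the
boundary of a cone is the base minus the cone over its boundary. The homotopy
agrees with this cone on all chains over [w]. *)
Lemma cech_homotopyP u :
  cech_bd (cech_homotopy u) + cech_homotopy (cech_bd u) = u.
Proof.
apply: (finfree_ext
  (p := (cech_bd \o cech_homotopy) \+ (cech_homotopy \o cech_bd))
  (q := idfun)) => -[w t] /=.
rewrite cech_homotopy_delta !cech_bd_delta /cech_bd_fun /=.
rewrite cech_homotopy_over linearB.
by rewrite addrNK /= over_pt_delta.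
Qed.

(** Coning and placing over a point are equivariant in all their arguments. *)
Lemma cech_bd_act g (p : T) :
  cech_bd_fun (gset_act g p) = rgmod_act g (cech_bd_fun p).
Proof.
have coneE q u : cone (gset_act g q) (rgmod_act g u) = rgmod_act g (cone q u).
  apply: (finfree_ext (p := cone (gset_act g q) \o permmod_act g)
    (q := permmod_act g \o cone q)) => t /=.
  by rewrite permmod_act_delta !cone_delta permmod_act_delta.
have overE w u : over_pt (gset_act g w) (rgmod_act g u) =
    rgmod_act g (over_pt w u).
  apply: (finfree_ext (p := over_pt (gset_act g w) \o permmod_act g)
    (q := permmod_act g \o over_pt w)) => t /=.
  by rewrite permmod_act_delta !over_pt_delta permmod_act_delta.
case: p => w t; rewrite /cech_bd_fun /= -overE; congr over_pt.
elim: t => [|q t IHt]; first by rewrite linear0.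
rewrite [LHS]/= IHt coneE [RHS]linearB; congr (_ - _).
exact: esym (@permmod_act_delta R G (gseq Q) g t).
Qed.

Definition fibre_seq n (w : X) : set (seq Q) :=
  [set t | size t = n /\ all (fun q => `[< pi q = w >]) t].

Definition fibre_power_set n : set T := [set p | fibre_seq n p.1 p.2].

Lemma fibre_power_invariant n : ginvariant (fibre_power_set n).
Proof.
move=> g [w t] [/= tn tw]; split=> /=; first by rewrite size_map.
rewrite all_map; apply: sub_all tw => q /asboolP qw /=.
by apply/asboolP; rewrite piE qw.
Qed.

Definition fibre_power n : gset G := gsub (@fibre_power_invariant n).
Local Notation Fn n := (permmod R (fibre_power n)).

Lemma fibre_power_proper n : gproper (fibre_power n).
Proof. exact/gproper_sub/gproper_prod/gdiscrete_seq. Qed.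

(** This is where finite fibres of [pi] enter: they make every [fibre_power]
a G-set with finitely many orbits. *)
Lemma fibre_seq_finite n w : finite_set (fibre_seq n w).
Proof.
elim: n => [|n IHn].
  by apply: (sub_finite_set _ (finite_set1 [::])) => t [/size0nil].
apply: (sub_finite_set _ (finite_image (fun p => p.1 :: p.2)
  (finite_setX (pi_fin w) IHn))).
move=> [|q t] [//= [tn]] /andP[/asboolP qw tw].
by exists (q, t).
Qed.

Lemma fibre_power_finite n : gfinite (fibre_power n).
Proof.
apply: (@gfinite_fibres _ X (fibre_power n) (fun p => (sval p).1)) => // w.
have Ffin : finite_set [set p : T | p.1 = w /\ fibre_seq n w p.2].
  apply: (sub_finite_set _ (finite_image (fun t => (w, t) : T)
    (fibre_seq_finite n w))).
  by move=> [w' t] /= [-> tw]; exists t.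
apply: (sub_finite_set _
  (finite_preimage (f := @sval _ (fibre_power_set n)) _ Ffin)).
  by move=> [[w' t] /= tw'] /= <-.
by move=> [p Tp] [p' Tp'] _ _ /= pp'; exact: eq_exist.
Qed.

Lemma sval_equivariant n :
  @gequivariant G (fibre_power n) T (fun p => sval p).
Proof. by []. Qed.

Definition fibre_incl n : rghom (Fn n) FT :=
  permmod_map R (@sval_equivariant n).

Lemma fibre_incl_inj n : injective (fibre_incl n).
Proof. by apply: push_inj => -[p Tp] [p' Tp'] /= pp'; exact: eq_exist. Qed.

Lemma fibre_incl_delta n (p : fibre_power n) :
  fibre_incl n (delta p) = delta (sval p).
Proof. exact: permmod_map_delta. Qed.

Lemma fibre_inclP n v :
  supported (fibre_power_set n) v -> exists u, fibre_incl n u = v.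
Proof.
move=> vS; exists (pull (fun p : fibre_power n => sval p) v).
apply: pullK => p /vS pS.
by exists (exist _ p pS).
Qed.

Lemma fibre_incl_supported n u : supported (fibre_power_set n) (fibre_incl n u).
Proof.
move=> p up; have [[p' pS] _ <-] := push_supported up.
exact: pS.
Qed.

(** Removing an entry from a sequence in one fibre leaves a sequence in that
fibre, one step shorter. *)
Lemma seq_bd_supported n w t :
  fibre_seq n.+1 w t -> supported (fibre_seq n w) (seq_bd_fun t).
Proof.
elim: t n => [|q t IHt] n [] //= [tn] /andP[qw tw].
apply: supportedB; first exact: supported_delta.
case: t tn tw IHt => [|q' t] tn tw IHt.
  by rewrite linear0; exact: supported0.
case: n tn => // n tn; apply: (@supported_linext _ _ _ _ (fibre_seq n w)).
  by move=> t' [t'n t'w]; apply: supported_delta; split=> /=; rewrite ?t'n ?qw.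
exact: IHt.
Qed.

Lemma cech_bd_supported n u :
  supported (fibre_power_set n) (cech_bd (fibre_incl n.+1 u)).
Proof.
apply: (@supported_linext _ _ _ _ (fibre_power_set n.+1)); last first.
  exact: fibre_incl_supported.
move=> [w t] tw; apply: (@supported_linext _ _ _ _ (fibre_seq n w)).
  by move=> t' t'w; exact: supported_delta.
exact: seq_bd_supported.
Qed.

Lemma cech_diff_exists n : exists d : rghom (Fn n.+1) (Fn n),
  forall u, fibre_incl n (d u) = cech_bd (fibre_incl n.+1 u).
Proof.
have /choice[d dP] : forall u : Fn n.+1,
    exists v, fibre_incl n v = cech_bd (fibre_incl n.+1 u).
  by move=> u; apply/fibre_inclP/cech_bd_supported.
have d_lin : linear d.
  by move=> a u v; apply: fibre_incl_inj; rewrite dP !linearP !dP.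
have d_act g u : d (rgmod_act g u) = rgmod_act g (d u).
  apply: fibre_incl_inj; rewrite dP !rghom_act dP.
  exact: (permmod_linext_act cech_bd_act).
by exists (rghom_of d_lin d_act).
Qed.

Definition cech_diff n : rghom (Fn n.+1) (Fn n) :=
  sval (cid (cech_diff_exists n)).

Lemma cech_diffE n u :
  fibre_incl n (cech_diff n u) = cech_bd (fibre_incl n.+1 u).
Proof. by rewrite /cech_diff; case: cid. Qed.

Lemma cech_diff_diff n u : cech_diff n (cech_diff n.+1 u) = 0.
Proof. by apply: fibre_incl_inj; rewrite !cech_diffE cech_bd_bd linear0. Qed.

(** By [cech_homotopyP] a cycle is the boundary of its image under the homotopy,
and the homotopy preserves the fibre condition. *)
Lemma cech_exact n u : cech_diff n u = 0 -> exists v, cech_diff n.+1 v = u.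
Proof.
move=> du.
have [v vE] : exists v, fibre_incl n.+2 v = cech_homotopy (fibre_incl n.+1 u).
  apply: fibre_inclP; apply: (@supported_linext _ _ _ _ (fibre_power_set n.+1)).
    move=> [w t] [/= tn tw]; apply: supported_delta; split=> /=.
      by rewrite tn.
    by rewrite tw andbT; apply/asboolP/fibre_sectionK.
  exact: fibre_incl_supported.
exists v; apply: fibre_incl_inj; rewrite cech_diffE vE -[RHS]cech_homotopyP.
by rewrite -cech_diffE du !linear0 addr0.
Qed.

(** All kernels are treated at once: the kernel in degree [n] is covered by
[R[fibre_power n.+2]] with the next kernel of the complex as kernel. *)
Lemma cech_ker_fp k n : fp k (rgker (cech_diff n)).
Proof.
elim: k n => //= k IHk n.
exists (fibre_power n.+2), (rgker (cech_diff n.+1)), (rgker_incl _).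
exists (rgker_lift (@cech_diff_diff n)); split=> //.
- exact: fibre_power_proper.
- exact: fibre_power_finite.
- apply/short_exactP; split.
  + exact: rgker_incl_inj.
  + by move=> x; apply: rgker_incl_inj; rewrite rgker_liftK rgker_incl0 linear0.
  + move=> v /(congr1 (rgker_incl _)); rewrite rgker_liftK linear0.
    exact: rgker_inclP.
  + move=> z; have [v vz] := cech_exact (rgker_incl0 z).
    by exists v; apply: rgker_incl_inj; rewrite rgker_liftK.
Qed.

Lemma fibre_power0P (x : X) : fibre_power_set 0 (x, [::]). Proof. by []. Qed.

Lemma fibre_power1P (q : Q) : fibre_power_set 1 (pi q, [:: q]).
Proof. by split=> //=; rewrite asboolT. Qed.

(** [Q] and [X] are the fibre powers 1 and 0, and [pi] becomes the lowest Cech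
differential. *)
Lemma ker_permmod_map_fp k : fp k (rgker (permmod_map R piE)).
Proof.
pose a (q : Q) : fibre_power 1 := exist _ _ (fibre_power1P q).
pose b (x : X) : fibre_power 0 := exist _ _ (fibre_power0P x).
have aE : gequivariant a by move=> g q; apply: eq_exist; rewrite /= piE.
have bE : gequivariant b by move=> g x; apply: eq_exist.
have ainj : injective (permmod_map R aE) by apply: push_inj => q q' [].
have binj : injective (permmod_map R bE) by apply: push_inj => x x' [].
have asurj v : exists u, permmod_map R aE u = v.
  apply: push_surj => -[[w [|q [|q' t]]] Tp]; have [//= _ tw] := Tp.
  exists q; apply: eq_exist; congr (_, _).
  by move: tw => /andP[/asboolP].
have dab u : cech_diff 0 (permmod_map R aE u) =
    permmod_map R bE (permmod_map R piE u).
  apply: (finfree_ext (p := cech_diff 0 \o permmod_map R aE)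
    (q := permmod_map R bE \o permmod_map R piE)) => q.
  apply: (fibre_incl_inj (n := 0)).
  change (fibre_incl 0 (cech_diff 0 (permmod_map R aE (delta q))) =
    fibre_incl 0 (permmod_map R bE (permmod_map R piE (delta q)))).
  rewrite cech_diffE [permmod_map R aE _]permmod_map_delta.
  rewrite [permmod_map R piE _]permmod_map_delta.
  rewrite [permmod_map R bE _]permmod_map_delta !fibre_incl_delta.
  rewrite [cech_bd _]cech_bd_delta /cech_bd_fun /=.
  by rewrite linear0 subr0 over_pt_delta.
have aL u :
    cech_diff 0 (permmod_map R aE (rgker_incl (permmod_map R piE) u)) = 0.
  by rewrite dab rgker_incl0 linear0.
pose e := rgker_lift (f := cech_diff 0)
  (h := rgcomp (permmod_map R aE) (rgker_incl (permmod_map R piE))) aL.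
have einj : injective e.
  move=> u v /(congr1 (rgker_incl _)); rewrite !rgker_liftK => /ainj.
  exact: rgker_incl_inj.
have esurj z : exists u, e u = z.
  have [u uz] := asurj (rgker_incl _ z).
  have /rgker_inclP[v vu] : permmod_map R piE u = 0.
    by apply: binj; rewrite -dab uz rgker_incl0 linear0.
  exists v; apply: rgker_incl_inj; rewrite rgker_liftK -uz -vu; exact: erefl.
have [e' [eK e'K]] := rghom_inverse einj esurj.
apply: (fp_iso (f := e') _ _ (@cech_ker_fp k 0)); first exact: can_inj e'K.
by move=> u; exists (e u).
Qed.

End Cech.

(** * Finiteness types in short exact sequences *)

Section ShortExactSequences.
Variables (R : comPzRingType) (G : topologicalGroupType).
Implicit Types K L M N : rgmodule R G.

Lemma short_exact_ker_iso L M N (f : rghom L M) (h : rghom M N) :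
  short_exact f h -> exists e : rghom L (rgker h),
    injective e /\ forall z, exists l, e l = z.
Proof.
move=> /short_exactP[finj hf fh _]; exists (rgker_lift hf); split.
- by move=> u v /(congr1 (rgker_incl h)); rewrite !rgker_liftK => /finj.
- move=> z; have [l lz] := fh _ (rgker_incl0 z); exists l.
  by apply: rgker_incl_inj; rewrite rgker_liftK.
Qed.

Lemma fp_ker k L M N (f : rghom L M) (h : rghom M N) :
  short_exact f h -> fp k L <-> fp k (rgker h).
Proof.
move=> /short_exact_ker_iso[e [einj esurj]]; split.
  exact: fp_iso einj esurj.
have [e' [eK e'K]] := rghom_inverse einj esurj.
apply: (fp_iso (f := e')); first exact: can_inj e'K.
by move=> l; exists (e l).
Qed.

Lemma fpSP k M : fp k.+1 M <->
  exists (X : gset G) (p : rghom (permmod R X) M),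
    [/\ gproper X, gfinite X, forall m, exists u, p u = m & fp k (rgker p)].
Proof.
split=> [[X [K [i [p [Xp Xf ip Kk]]]]]|[X [p [Xp Xf psurj Kk]]]].
  exists X, p; split=> //; first by have /short_exactP[] := ip.
  by have [/(_ Kk)] := fp_ker k ip.
exists X, (rgker p), (rgker_incl p), p; split=> //.
exact: short_exact_ker.
Qed.

(** A named property, because covers are lifted inside the induction that proves
it. *)
Definition fp_extension k := forall L M N (f : rghom L M) (h : rghom M N),
  short_exact f h -> discrete_module M -> fp k L -> fp k N -> fp k M.

(** Replacing a cover of [N] by one that factors through [M] enlarges its kernel
by the kernel of [R[Q] -> R[X]], which satisfies every [fp k]. *)
Lemma fp_lifted_cover k M N (h : rghom M N) : fp_extension k ->
  (forall n, exists m, h m = n) -> discrete_module M -> fp k.+1 N ->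
  exists (Q : gset G) (psi : rghom (permmod R Q) M),
    [/\ gproper Q, gfinite Q, forall n, exists u, h (psi u) = n &
        fp k (rgker (rgcomp h psi))].
Proof.
move=> extk hsurj Md /fpSP[X [p [Xp Xf psurj Kk]]].
have p_act g (x : X) : p (delta (gset_act g x)) = rgmod_act g (p (delta x)).
  by rewrite -rghom_act -[LHS]/(p _) -permmod_act_delta.
have [Q [pi [psi [Qp piE psiE [hpsi pisurj pifin]]]]] :=
  equivariant_lift_cover hsurj Md Xp Xf p_act.
pose psih := permmod_hom psiE; pose pih := permmod_map R piE.
have Qf : gfinite Q by exact: gfinite_fibres piE Xf pifin.
have hpsih u : h (psih u) = p (pih u).
  apply: (finfree_ext (p := h \o psih) (q := p \o pih)) => q.
  apply: etrans (congr1 h (linext_delta psi q)) (etrans (hpsi q) _).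
  by congr (p _); rewrite /pih permmod_map_delta.
have pihsurj v : exists u, pih u = v by exact: push_surj.
exists Q, psih; split=> //.
  move=> n; have [v <-] := psurj n; have [u <-] := pihsurj v.
  by exists u.
have [i [q iq]] := short_exact_ker_comp (w := rgcomp h psih) hpsih pihsurj.
apply: (extk _ _ _ _ _ iq) => //.
- exact/discrete_ker/discrete_permmod/gproper_discrete.
- exact: ker_permmod_map_fp (gproper_discrete Qp) _ _ _.
Qed.

Section SumPermutation.
Variables (X Y : gset G).

Lemma inl_equivariant : @gequivariant G X (gsum X Y) inl. Proof. by []. Qed.
Lemma inr_equivariant : @gequivariant G Y (gsum X Y) inr. Proof. by []. Qed.

Definition permmod_inl := permmod_map R inl_equivariant.
Definition permmod_inr := permmod_map R inr_equivariant.

Lemma permmod_case_act M (p : rghom (permmod R X) M) (q : rghom (permmod R Y) M)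
    (phi := fun s : gsum X Y =>
      match s with inl x => p (delta x) | inr y => q (delta y) end) g s :
  phi (gset_act g s) = rgmod_act g (phi s).
Proof.
case: s => [x|y]; rewrite /phi /= -permmod_act_delta.
  exact: (rghom_act p g (delta x)).
exact: (rghom_act q g (delta y)).
Qed.

Definition permmod_case M (p : rghom (permmod R X) M)
    (q : rghom (permmod R Y) M) : rghom (permmod R (gsum X Y)) M :=
  permmod_hom (permmod_case_act p q).

Lemma permmod_case_inl M p q u : @permmod_case M p q (permmod_inl u) = p u.
Proof.
apply: (finfree_ext (p := permmod_case p q \o permmod_inl) (q := p)) => x.
apply: etrans (congr1 _ (permmod_map_delta _ _ x)) _.
exact: linext_delta.
Qed.

Lemma permmod_case_inr M p q u : @permmod_case M p q (permmod_inr u) = q u.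
Proof.
apply: (finfree_ext (p := permmod_case p q \o permmod_inr) (q := q)) => x.
apply: etrans (congr1 _ (permmod_map_delta _ _ x)) _.
exact: linext_delta.
Qed.

Lemma permmod_sumP (w : permmod R (gsum X Y)) :
  exists u v, w = permmod_inl u + permmod_inr v.
Proof.
apply: (finfree_ind
  (Q := fun w => exists u v, w = permmod_inl u + permmod_inr v)) w =>
  [|w w' [u [v ->]] [u' [v' ->]]|a w [u [v ->]]|[x|y]].
- by exists 0, 0; rewrite !linear0 addr0.
- by exists (u + u'), (v + v'); rewrite !linearD addrACA.
- by exists (a *: u), (a *: v); rewrite !linearZ_LR scalerDr.
- exists (delta x), 0; rewrite linear0 addr0.
  exact: esym (permmod_map_delta _ _ x).
- exists 0, (delta y); rewrite linear0 add0r.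
  exact: esym (permmod_map_delta _ _ y).
Qed.

End SumPermutation.

Lemma rghom_zero_subproof M N g (m : M) :
  (0 : N) = rgmod_act g (0 : N).
Proof. by rewrite linear0. Qed.

Lemma zero_linear M N : linear (fun _ : M => 0 : N).
Proof. by move=> a u v; rewrite scaler0 addr0. Qed.

Definition rghom0 M N : rghom M N :=
  rghom_of (@zero_linear M N) (@rghom_zero_subproof M N).

Lemma id_linear M : linear (fun m : M => m). Proof. by []. Qed.

Definition rghom_id M : rghom M M :=
  rghom_of (@id_linear M) (fun g m => erefl).

(** The horseshoe construction. With [p : R[X] -> L] and a lifted cover
[psi : R[Q] -> M] of [N], the map [P] given by [f p] and [psi] is onto, and
projection to [R[Q]] yields [0 -> ker p -> ker P -> ker (h psi) -> 0]. *)
Lemma fp_ext k : fp_extension k.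
Proof.
elim: k => // k IHk L M N f h fh Md /fpSP[X [p [Xp Xf psurj pk]]] Nk.
have /short_exactP[finj hf hker hsurj] := fh.
have [Q [psi [Qp Qf psisurj psik]]] := fp_lifted_cover IHk hsurj Md Nk.
pose P := permmod_case (rgcomp f p) psi.
have Pl u : P (permmod_inl X Q u) = f (p u) by exact: permmod_case_inl.
have Pr u : P (permmod_inr X Q u) = psi u by exact: permmod_case_inr.
apply/fpSP; exists (gsum X Q), P; split.
- exact: gproper_sum.
- exact: gfinite_sum.
- move=> m; have [v hv] := psisurj (h m).
  have [|l lE] := hker (m - psi v); first by rewrite linearB hv subrr.
  have [u ul] := psurj l; exists (permmod_inl X Q u + permmod_inr X Q v).
  by rewrite linearD Pl Pr ul lE subrK.
pose pr := permmod_case (rghom0 (permmod R X) (permmod R Q))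
  (rghom_id (permmod R Q)).
have prl u : pr (permmod_inl X Q u) = 0 by exact: permmod_case_inl.
have prr u : pr (permmod_inr X Q u) = u by exact: permmod_case_inr.
have a0 u : P (rgcomp (permmod_inl X Q) (rgker_incl p) u) = 0.
  by rewrite [LHS]Pl rgker_incl0 linear0.
have hP w : h (P w) = h (psi (pr w)).
  have [u [v ->]] := permmod_sumP w.
  by rewrite !(linearD P, linearD pr) Pl Pr prl prr add0r linearD hf add0r.
have b0 u : rgcomp h psi (rgcomp pr (rgker_incl P) u) = 0.
  by rewrite -[LHS]hP rgker_incl0 linear0.
apply: (IHk _ _ _ (rgker_lift a0) (rgker_lift b0)) => //; last first.
  apply: discrete_ker; apply: discrete_permmod; apply: gproper_discrete.
  exact: gproper_sum.
apply/short_exactP; split.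
- move=> u v /(congr1 (rgker_incl _)); rewrite !rgker_liftK => uv.
  by apply: rgker_incl_inj; move: uv; apply: push_inj => x y [].
- by move=> u; apply: rgker_incl_inj; rewrite rgker_liftK linear0; exact: prl.
- move=> w /(congr1 (rgker_incl _)); rewrite rgker_liftK linear0.
  have := rgker_incl0 w; have [u [v wE]] := permmod_sumP (rgker_incl P w).
  move=> Pw prw; have v0 : v = 0.
    have : pr (rgker_incl P w) = 0 by exact: prw.
    by rewrite wE (linearD pr) prl prr add0r.
  have /rgker_inclP[u' u'u] : p u = 0.
    by apply: finj; move: Pw; rewrite wE v0 !linear0 addr0 Pl.
  exists u'; apply: rgker_incl_inj.
  rewrite rgker_liftK wE v0 linear0 addr0 -u'u; exact: erefl.
- move=> z; have /hker[l lz] : h (psi (rgker_incl _ z)) = 0.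
    exact: (rgker_incl0 z).
  have [u ul] := psurj l.
  have /rgker_inclP[w wE] :
      P (permmod_inr X Q (rgker_incl _ z) - permmod_inl X Q u) = 0.
    by rewrite linearB Pl Pr ul lz subrr.
  exists w; apply: rgker_incl_inj; rewrite rgker_liftK.
  by rewrite -[LHS]/(pr (rgker_incl P w)) wE linearB prl prr subr0.
Qed.

(** For a cover [p] of [M] the kernel of [h p] is an extension of [ker h],
which is [L], by [ker p]. *)
Lemma fp_quotient k L M N (f : rghom L M) (h : rghom M N) : short_exact f h ->
  fp k L -> fp k.+1 M -> fp k.+1 N.
Proof.
move=> fh /(fp_ker k fh) hk /fpSP[X [p [Xp Xf psurj pk]]].
have /short_exactP[_ _ _ hsurj] := fh.
apply/fpSP; exists X, (rgcomp h p); split=> //.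
  by move=> n; have [m <-] := hsurj n; have [u <-] := psurj m; exists u.
have [i [q iq]] :=
  short_exact_ker_comp (w := rgcomp h p) (fun u => erefl (h (p u))) psurj.
apply: (fp_ext iq) => //.
exact/discrete_ker/discrete_permmod/gproper_discrete.
Qed.

(** The sequence [0 -> ker (h psi) -> ker h (+) R[Q] -> M -> 0], where [psi]
lifts a cover of [N], replaces the splitting that a projective cover would
give. Its first map sends [u] to [(psi u, - u)]. *)
Lemma fp_kernel k L M N (f : rghom L M) (h : rghom M N) : short_exact f h ->
  discrete_module M -> fp k M -> fp k.+1 N -> fp k L.
Proof.
case: k => // k fh Md Mk Nk; apply/(fp_ker k.+1 fh).
have /short_exactP[_ _ _ hsurj] := fh.
have [Q [psi [Qp Qf psisurj psik]]] :=
  fp_lifted_cover (@fp_ext k.+1) hsurj Md Nk.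
pose S := rgsum (rgker h) (permmod R Q).
have s_lin : linear (fun z : S => rgker_incl h z.1 + psi z.2 : M).
  move=> a u v; rewrite scalerDr !linearP /= addrACA; exact: erefl.
have s_act g (z : S) : rgker_incl h (rgmod_act g z).1 + psi (rgmod_act g z).2 =
    rgmod_act g (rgker_incl h z.1 + psi z.2).
  by rewrite linearD -!rghom_act.
pose s : rghom S M := rghom_of s_lin s_act.
have c0 u : h (rgcomp psi (rgker_incl (rgcomp h psi)) u) = 0.
  exact: (rgker_incl0 u).
pose c := rgker_lift c0.
have t_lin : linear (fun u : rgker (rgcomp h psi) =>
    (c u, - rgker_incl (rgcomp h psi) u) : S).
  move=> a u v; apply: injective_projections; first exact: (linearP c).
  rewrite -[LHS]/(- rgker_incl (rgcomp h psi) (a *: u + v)).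
  by rewrite linearP opprD -scalerN.
have t_act g u : (c (rgmod_act g u),
      - rgker_incl (rgcomp h psi) (rgmod_act g u)) =
    rgmod_act g ((c u, - rgker_incl (rgcomp h psi) u) : S).
  rewrite !rghom_act; congr (_, _); exact: esym (linearN _ _).
pose t : rghom (rgker (rgcomp h psi)) S := rghom_of t_lin t_act.
have Sd : discrete_module S.
  by apply: discrete_sum; [exact: discrete_ker|
    exact/discrete_permmod/gproper_discrete].
have Sk : fp k.+1 S.
  apply: (fp_ext (f := t) (h := s)) => //; apply/short_exactP; split.
  - move=> u v /(congr1 snd) uv.
    apply: (@rgker_incl_inj _ _ _ _ (rgcomp h psi)); exact: oppr_inj uv.
  - by move=> u /=; rewrite linearN subrr.
  - move=> [x u] /eqP; rewrite addr_eq0 => /eqP xu.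
    have /rgker_inclP[v vu] : rgcomp h psi (- u) = 0.
      rewrite -[LHS]/(h (psi (- u))) linearN -xu; exact: rgker_incl0.
    exists v; apply: injective_projections; last first.
      exact: etrans (congr1 -%R vu) (opprK u).
    apply: rgker_incl_inj; rewrite -[LHS]/(psi (rgker_incl _ v)) vu linearN.
    exact: esym xu.
  - move=> m; have [u um] := psisurj (h m).
    have /rgker_inclP[x xE] : h (m - psi u) = 0 by rewrite linearB um subrr.
    by exists (x, u); rewrite -[LHS]/(rgker_incl h x + psi u) xE subrK.
have i_lin : linear (fun u : permmod R Q => (0, u) : S).
  move=> a u v; apply: injective_projections => //.
  exact: esym (etrans (addr0 _) (scaler0 (rgker h) a)).
have i_act g (u : permmod R Q) : (0, rgmod_act g u) = rgmod_act g ((0, u) : S).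
  by apply: injective_projections => //; exact: esym (linear0 _).
have p_lin : linear (fun z : S => z.1 : rgker h) by [].
apply: (fp_quotient (f := rghom_of i_lin i_act)
  (h := rghom_of p_lin (fun g z => erefl)) _ _ Sk); last exact: fp_permmod.
apply/short_exactP; split=> //=.
- by move=> u v [].
- by move=> [x u] /= ->; exists u.
- by move=> x; exists (x, 0).
Qed.

End ShortExactSequences.

(** * Comparison with resolutions *)

Section FreeBasis.
Variables (R : comPzRingType) (X : Type).

Lemma finfree_expand (u : finfree R X) :
  exists k (s : 'I_k -> X), injective s /\
    u = \sum_(i < k) (u (s i) : R) *: delta (s i).
Proof.
have [s [us sP]] := finfree_supp u.
exists (size s), (tnth (in_tuple s)); split.
  by move=> i j ij; have /tuple_uniqP inj : uniq (in_tuple s) := us; exact: inj.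
by rewrite -{1}(linext_id u) (linext_seq delta us sP) big_tnth.
Qed.

Lemma finfree_basis : is_basis (delta : X -> finfree R X).
Proof.
split=> [k s c sinj sum0 i|u]; last first.
  by have [k [s [_ uE]]] := finfree_expand u; exists k, s, (fun i => u (s i)).
have := congr1 (fun u : finfree R X => u (s i)) sum0.
rewrite finfree_sumE (bigD1 i)// finfree0E finfreeZE deltaE asboolT// mulr1.
rewrite big1; first by rewrite [LHS]addr0.
move=> j /eqP ji; rewrite finfreeZE deltaE asboolF ?mulr0// => /sinj ij.
exact: ji.
Qed.

End FreeBasis.

Section PermutationModules.
Variables (R : comPzRingType) (G : topologicalGroupType).

Lemma permmod_proper_discrete (X : gset G) :
  gproper X -> proper_discrete_permutation (permmod R X).
Proof.
move=> Xp; exists X, (delta : X -> finfree R X); split=> //.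
  exact: finfree_basis.
by move=> g x; rewrite -permmod_act_delta.
Qed.

(** The basis elements of orbit representatives generate. *)
Lemma permmod_fin_gen (X : gset G) : gfinite X -> fin_gen (permmod R X).
Proof.
move=> [S Sfin SX].
have /(@finite_seqP {classic X})[s sE] := Sfin.
exists (size s), (fun j => delta (tnth (in_tuple s) j)) => u.
have [l [t [_ uE]]] := finfree_expand u.
have /choice[gj gjP] : forall i, exists gj : G * 'I_(size s),
    t i = gset_act gj.1 (tnth (in_tuple s) gj.2).
  move=> i; have [g [x [Sx tx]]] := SX (t i).
  have xs : (x : {classic X}) \in s by have : [set` s] x by rewrite -sE.
  have /tnthP[j jx] : (x : {classic X}) \in in_tuple s by [].
  by exists (g, j); rewrite /= tx jx.
exists l, (fun i => u (t i)), (fun i => (gj i).1), (fun i => (gj i).2).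
rewrite [LHS]uE; apply: eq_bigr => i _; congr (_ *: _).
by rewrite [in LHS]gjP -permmod_act_delta.
Qed.

(** Finitely many generators involve finitely many basis elements. Their orbits
span the module, and [X] is the union of these orbits. Over the zero ring
this may be smaller than the given G-set, which can have infinitely many
orbits although the module is zero. *)
Lemma fin_gen_permmod (P : rgmodule R G) :
  proper_discrete_permutation P -> fin_gen P ->
  exists (X : gset G) (e : rghom (permmod R X) P),
    [/\ gproper X, gfinite X, injective e & forall m, exists u, e u = m].
Proof.
move=> [W [e [[efree espan] eE Wp]]] [k [x xgen]].
have /choice[f fP] : forall j, exists f : {n & ('I_n -> W) * ('I_n -> R)}%type,
    x j = \sum_(i < projT1 f) (projT2 f).2 i *: e ((projT2 f).1 i).
  by move=> j; have [n [s [c xE]]] := espan (x j); exists (existT _ n (s, c)).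
pose S0 := \bigcup_(j in [set: 'I_k]) range (projT2 (f j)).1.
have S0fin : finite_set S0.
  by apply: bigcup_finite => // j _; exact: finite_image.
pose W1 : set W := [set w | exists g s, S0 s /\ w = gset_act g s].
have invW1 : ginvariant W1.
  move=> g _ [g' [s [Ss ->]]]; exists (g * g')%g, s.
  by rewrite gset_actM.
pose X := gsub invW1.
have e_act g (w : X) : e (sval (gset_act g w)) = rgmod_act g (e (sval w)).
  exact: eE.
pose e1 := permmod_hom (X := X) (phi := fun w => e (sval w)) e_act.
have e1_delta w : e1 (delta w) = e (sval w) by exact: linext_delta.
exists X, e1; split.
- exact: gproper_sub.
- exists (@sval W W1 @^-1` S0).
    apply: finite_preimage => // -[p Tp] [p' Tp'] _ _ /= pp'.
    exact: eq_exist.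
  move=> [w Ww]; have [g [s [Ss ws]]] := Ww.
  have Ws : W1 s by exists 1%g, s; rewrite gset_act1.
  by exists g, (exist _ s Ws); split=> //; exact: eq_exist.
- suff e10 u : e1 u = 0 -> u = 0.
    move=> u v uv; apply/eqP; rewrite -subr_eq0; apply/eqP/e10.
    by rewrite linearB uv subrr.
  have [n [s [sinj uE]]] := finfree_expand u.
  move=> e1u; have c0 : forall i, u (s i) = 0 :> R.
    apply: (efree _ (fun i => sval (s i)) (fun i => u (s i))).
      move=> i j; move: (sinj i j); case: (s i) => p Tp; case: (s j) => p' Tp'.
      by move=> + /= pp'; apply; exact: eq_exist.
    rewrite -[RHS]e1u [in RHS]uE linear_sum; apply: eq_bigr => i _.
    by rewrite linearZ_LR e1_delta.
  by rewrite uE big1// => i _; rewrite c0 scale0r.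
- have im0 : exists u, e1 u = 0 by exists 0; rewrite linear0.
  have imD m m' : (exists u, e1 u = m) -> (exists u, e1 u = m') ->
      exists u, e1 u = m + m'.
    by move=> [u <-] [v <-]; exists (u + v); rewrite linearD.
  have imZ a m : (exists u, e1 u = m) -> exists u, e1 u = a *: m.
    by move=> [u <-]; exists (a *: u); rewrite linearZ_LR.
  have imsum (n : nat) (F : 'I_n -> P) : (forall i, exists u, e1 u = F i) ->
      exists u, e1 u = \sum_(i < n) F i.
    by move=> F_im; apply: (big_ind (fun m => exists u, e1 u = m)).
  have imx j : exists u, e1 u = x j.
    rewrite fP; apply: imsum => i; apply: imZ.
    have Ws : W1 ((projT2 (f j)).1 i).
      exists 1%g, ((projT2 (f j)).1 i); rewrite gset_act1; split=> //.
      by exists j.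
    by exists (delta (exist _ _ Ws : X)); rewrite e1_delta.
  move=> m; have [l [c [g [j ->]]]] := xgen m.
  apply: imsum => i; apply: imZ; have [u <-] := imx (j i).
  by exists (rgmod_act (g i) u); rewrite rghom_act.
Qed.

End PermutationModules.

Section Resolutions.
Variables (R : comPzRingType) (G : topologicalGroupType).
Implicit Types K L M N P : rgmodule R G.

(** Dropping the first term of a resolution resolves the kernel of the
augmentation. The first term is replaced by an isomorphic module, so that the
result fits the kernels used in [fp]. *)
Lemma resolution_shift M (P : resolution M) P0 (e : rghom P0 (P 0%N)) :
  injective e -> (forall m, exists u, e u = m) ->
  exists Q : resolution (rgker (rgcomp (res_aug P) e)),
    forall i, res_mod Q i = P i.+1.
Proof.
move=> einj esurj; have [e' [eK e'K]] := rghom_inverse einj esurj.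
have /exact_atP[ad da] := res_exact0 P.
have a0 u : rgcomp (res_aug P) e (rgcomp e' (res_diff P 0%N) u) = 0.
  by rewrite /= e'K ad.
pose aug := rgker_lift a0.
have aug_surj : range aug = setT.
  apply/seteqP; split=> // z _.
  have [u uz] := da _ (rgker_incl0 z); exists u => //.
  by apply: rgker_incl_inj; rewrite rgker_liftK /= uz eK.
have aug_exact : exact_at (res_diff P 1%N) aug.
  have /exact_atP[dd ddE] := res_exactS P 0%N.
  apply/exact_atP; split=> [u|u].
    by apply: rgker_incl_inj; rewrite rgker_liftK linear0 /= dd linear0.
  move=> /(congr1 (rgker_incl _)); rewrite rgker_liftK linear0 => u0.
  apply: ddE; rewrite -[LHS]e'K.
  by rewrite -[LHS]/(e (rgcomp e' (res_diff P 0%N) u)) u0 linear0.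
by exists (@Resolution R G _ (fun i => P i.+1) (fun i => res_diff P i.+1) aug
  aug_surj aug_exact (fun i => res_exactS P i.+1)).
Qed.

Lemma resolution_fp k M (P : resolution M) :
  (forall i, proper_discrete_permutation (P i)) ->
  (forall i, (i < k)%N -> fin_gen (P i)) -> fp k M.
Proof.
elim: k M P => // k IHk M P Pp Pf.
have [X [e [Xp Xf einj esurj]]] := fin_gen_permmod (Pp 0%N) (Pf 0%N isT).
apply/fpSP; exists X, (rgcomp (res_aug P) e); split=> //.
  move=> m; have [v _ <-] : range (res_aug P) m by rewrite res_aug_surj.
  by have [u <-] := esurj v; exists u.
have [Q QE] := resolution_shift einj esurj.
apply: (IHk _ Q) => i; rewrite QE; first exact: Pp.
by move=> ik; exact: Pf.
Qed.

Section Build.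
Variables (Inv : nat -> rgmodule R G -> Prop) (A : nat -> rgmodule R G -> Prop).
Hypothesis step : forall i K, Inv i K -> exists P (p : rghom P K),
  [/\ forall m, exists u, p u = m, A i P & Inv i.+1 (rgker p)].

Record cover_of i K := CoverOf {
  cover_mod : rgmodule R G;
  cover_map : rghom cover_mod K;
  cover_surj : forall m, exists u, cover_map u = m;
  cover_A : A i cover_mod;
  cover_inv : Inv i.+1 (rgker cover_map) }.

Definition choose_cover i (K : {K | Inv i K}) : cover_of i (sval K) :=
  let P := cid (step (svalP K)) in let p := cid (svalP P) in
  let: And3 psurj AP pinv := svalP p in CoverOf psurj AP pinv.

Variables (M : rgmodule R G) (M0 : Inv 0 M).

Fixpoint syzygy i : {K | Inv i K} :=
  if i is i'.+1 then exist _ _ (cover_inv (choose_cover (syzygy i')))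
  else exist _ M M0.

(** Splicing covers of successive kernels. The invariant [Inv i] is what
is known about the [i]-th kernel, and [A i] what the [i]-th term has to
satisfy. *)
Lemma resolution_exists : exists P : resolution M, forall i, A i (P i).
Proof.
pose C i := choose_cover (syzygy i).
pose d i : rghom (cover_mod (C i.+1)) (cover_mod (C i)) :=
  rgcomp (rgker_incl (cover_map (C i))) (cover_map (C i.+1)).
have ex_d i : forall L (h : rghom (cover_mod (C i)) L),
    (forall u, h u = 0 <-> cover_map (C i) u = 0) -> exact_at (d i) h.
  move=> L h hE; apply/exact_atP; split=> [u|u /hE].
    by apply/hE; exact: rgker_incl0.
  move=> /rgker_inclP[v vu]; have [w wv] := cover_surj (C i.+1) v.
  by exists w; rewrite /= wv.
have aug_surj : range (cover_map (C 0%N)) = setT.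
  apply/seteqP; split=> // m _.
  by have [u um] := cover_surj (C 0%N) m; exists u.
have ex0 : exact_at (d 0%N) (cover_map (C 0%N)) by exact: ex_d.
have exS i : exact_at (d i.+1) (d i).
  apply: ex_d => u; split=> [du|du].
    by apply: rgker_incl_inj; exact: etrans du (esym (linear0 _)).
  exact: etrans (congr1 (rgker_incl _) du) (linear0 _).
exists (@Resolution R G M (fun i => cover_mod (C i)) d (cover_map (C 0%N))
  aug_surj ex0 exS) => i.
exact: cover_A.
Qed.

End Build.

Lemma type_FP_trivial n M : (forall m : M, m = 0) -> type_FP n M.
Proof.
move=> M0.
pose A (i : nat) P := proper_discrete_permutation P /\ fin_gen P.
have [|P PA] := @resolution_exists (fun _ K => forall m : K, m = 0) A _ M M0.
  move=> i K K0; exists (permmod R (gempty G)), (rghom0 _ K); split.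
  - by move=> m; exists 0; rewrite [RHS]K0 [LHS]K0.
  - split; first exact/permmod_proper_discrete/gproper_empty.
    exact/permmod_fin_gen/gfinite_empty.
  - by move=> u; apply: rgker_incl_inj; apply: finfreeP => -[].
by exists P; split=> i => [|_]; have [] := PA i.
Qed.

(** The invariant for the [i]-th kernel is [fp (n.+1 - i)]: truncated
subtraction makes it empty beyond degree [n], where the covers [R[X0 * K]]
take over. *)
Lemma fp_type_FP n M : discrete_module M -> fp n.+1 M -> type_FP (Fin n) M.
Proof.
move=> Md Mfp; have /fpSP[X0 [p0 [X0p _ p0surj _]]] := Mfp.
have [[x0 _]|X0empty] := pselect (exists x : X0, True); last first.
  apply: type_FP_trivial => m; have [u <-] := p0surj m.
  have -> : u = 0 by apply: finfreeP => x; exfalso; apply: X0empty; exists x.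
  exact: linear0.
pose A (i : nat) P :=
  proper_discrete_permutation P /\ ((i <= n)%N -> fin_gen P).
pose Inv i K := discrete_module K /\ fp (n.+1 - i) K.
have [||P PA] := @resolution_exists Inv A _ M; last 2 first.
- by split=> //; rewrite subn0.
- by exists P; split=> i; have [? ?] := PA i.
move=> i K [Kd Kfp]; have [ni|ni] := leqP i n.
  move: Kfp; rewrite subSn// => /fpSP[X [p [Xp Xf psurj pfp]]].
  exists (permmod R X), p; split=> //.
    split; first exact: permmod_proper_discrete.
    by move=> _; exact: permmod_fin_gen.
  split; last by rewrite subSS.
  by apply: discrete_ker; apply: discrete_permmod; exact: gproper_discrete.
(* A point of [X0] in the first component makes the stabilisers compact. *)
pose X := gprod X0 (gmod K).
have Xp : gproper X by exact: gproper_prod.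
pose p := permmod_hom (X := X) (phi := fun x => x.2 : K) (fun g x => erefl).
exists (permmod R X), p; split.
- by move=> m; exists (delta ((x0, m) : X)); exact: linext_delta.
- split; first exact: permmod_proper_discrete.
  by move=> /(leq_trans ni); rewrite ltnn.
- split.
    by apply: discrete_ker; apply: discrete_permmod; exact: gproper_discrete.
  by rewrite (eqP (_ : n.+1 - i.+1 == 0))%N// subn_eq0 ltnW.
Qed.

(** By [fp_kernel] any finitely generated cover has a kernel that satisfies
every [fp k], so the covers may be chosen one after the other. *)
Lemma fp_type_FP_infty M : discrete_module M -> (forall k, fp k M) ->
  type_FP Infty M.
Proof.
move=> Md Mfp.
pose A (i : nat) P := proper_discrete_permutation P /\ fin_gen P.
pose Inv (i : nat) K := discrete_module K /\ forall k, fp k K.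
have [||P PA] := @resolution_exists Inv A _ M; last 2 first.
- by [].
- by exists P; split=> i => [|_]; have [] := PA i.
move=> i K [Kd Kfp]; have /fpSP[X [p [Xp Xf psurj _]]] := Kfp 1%N.
have Pd : discrete_module (permmod R X).
  by apply: discrete_permmod; exact: gproper_discrete.
exists (permmod R X), p; split=> //.
  by split; [exact: permmod_proper_discrete | exact: permmod_fin_gen].
split=> [|k]; first exact: discrete_ker.
apply: (fp_kernel (short_exact_ker psurj)) => //; exact: fp_permmod.
Qed.

Lemma type_FPP n M : discrete_module M -> type_FP n M <->
  if n is Fin k then fp k.+1 M else forall k, fp k M.
Proof.
move=> Md; case: n => [n|].
  split=> [[P [Pp Pf]]|]; last exact: fp_type_FP.
  by apply: (resolution_fp (P := P)) => // i; rewrite ltnS; exact: Pf.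
split=> [[P [Pp Pf]] k|]; last exact: fp_type_FP_infty.
by apply: (resolution_fp (P := P)) => // i _; exact: Pf.
Qed.

Lemma type_FP_predP n M : discrete_module M -> type_FP_pred n M <->
  if n is Fin k then fp k M else forall k, fp k M.
Proof.
by move=> Md; case: n => [[|n]|] //; [exact: (type_FPP (Fin n))|
  exact: (type_FPP Infty)].
Qed.

End Resolutions.

Theorem corollary3p12 (G : topologicalGroupType) (hG : tdlc G)
    (R : comPzRingType) (n : extnat) (M' M M'' : rgmodule R G)
    (hM' : discrete_module M') (hM : discrete_module M)
    (hM'' : discrete_module M'')
    (f : rghom M' M) (g : rghom M M'') (hfg : short_exact f g) :
  [/\ type_FP_pred n M' -> type_FP n M -> type_FP n M'',
      type_FP_pred n M -> type_FP n M'' -> type_FP_pred n M'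
    & type_FP n M' -> type_FP n M'' -> type_FP n M].
Proof.
split.
- move=> /(type_FP_predP _ hM') + /(type_FPP _ hM) => M'n Mn.
  apply/(type_FPP _ hM''); case: n M'n Mn => [n|] M'n Mn.
    exact: fp_quotient hfg M'n Mn.
  by case=> // k; exact: fp_quotient hfg (M'n k) (Mn k.+1).
- move=> /(type_FP_predP _ hM) + /(type_FPP _ hM'') => Mn M''n.
  apply/(type_FP_predP _ hM'); case: n Mn M''n => [n|] Mn M''n.
    exact: fp_kernel hfg hM Mn M''n.
  by move=> k; exact: fp_kernel hfg hM (Mn k) (M''n k.+1).
- move=> /(type_FPP _ hM') + /(type_FPP _ hM'') => M'n M''n.
  apply/(type_FPP _ hM); case: n M'n M''n => [n|] M'n M''n.
    exact: fp_ext hfg hM M'n M''n.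
  by move=> k; exact: fp_ext hfg hM (M'n k) (M''n k).
Qed.
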